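(* Let $(\mathcal C,\mathbb E,\mathfrak s)$ be an extriangulated category satisfying Condition (WIC), and let $\xi$ be a proper class of $\mathbb E$-triangles such that $\mathcal C$ has enough $\xi$-projectives and enough $\xi$-injectives. Let $M$ be an object of $\mathcal C$ of finite quasi-$\xi$-Gorenstein injective dimension and let $n$ be a positive integer. Then the following are equivalent: (1) $\xi\text{-}\mathcal{QG}\mathrm{id}(M)\le n$. (2) $\xi\mathrm{xt}_\xi^{\,n+i}(Q,M)=0$ for all $i\ge1$ and all $Q\in\mathcal{QI}(\xi)$. (3) For any integer $i$ with $0\le i\le n$ there exists a $\xi$-exact complex $M\to G_0\to G_{-1}\to\cdots\to G_{-(n-1)}\to G_{-n}$ such that $G_{-i}\in\mathcal{QGI}(\xi)$ and $G_{-j}\in\mathcal I(\xi)$ for all $j\ne i$. Moreover, $$\xi\text{-}\mathcal{QG}\mathrm{id}(M)=\sup\{m\in\mathbb N\mid \exists\, Q\in\mathcal{QI}(\xi)\text{ such that }\xi\mathrm{xt}_\xi^{\,m}(Q,M)\neq0\}.$$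
   Context: Extriangulated categories (Nakaoka–Palu). $\mathcal C$ is an additive category with a biadditive functor $\mathbb E:\mathcal C^{op}\times\mathcal C\to\mathbf{Ab}$. An element $\delta\in\mathbb E(C,A)$ is an $\mathbb E$-extension; write $a_*\delta=\mathbb E(C,a)(\delta)$ and $c^*\delta=\mathbb E(c,A)(\delta)$. A morphism $(a,c):\delta\to\delta'$ from $\delta\in\mathbb E(C,A)$ to $\delta'\in\mathbb E(C',A')$ is a pair $a:A\to A'$, $c:C\to C'$ with $a_*\delta=c^*\delta'$. Sequences $A\to B\to C$ and $A\to B'\to C$ are equivalent if there is an isomorphism $B\to B'$ compatible with $1_A,1_C$. A realization $\mathfrak s$ assigns to each $\delta\in\mathbb E(C,A)$ an equivalence class $[A\xrightarrow{x}B\xrightarrow{y}C]$ such that every morphism $(a,c)$ of extensions extends to a commutative $(a,b,c)$ between the realizing sequences; it is additive if $\mathfrak s(0)=[A\to A\oplus C\to C]$ and $\mathfrak s(\delta\oplus\delta')=\mathfrak s(\delta)\oplus\mathfrak s(\delta')$. The triple is extriangulated if: (ET1) $\mathbb E$ is biadditive; (ET2) $\mathfrak s$ is an additive realization; (ET3) if $A\xrightarrow{x}B\xrightarrow{y}C$, $A'\xrightarrow{x'}B'\xrightarrow{y'}C'$ realize $\delta,\delta'$ and $bx=x'a$, then there is $c$ with $cy=y'b$ and $a_*\delta=c^*\delta'$; (ET3)$^{op}$ the dual; (ET4) if $A\xrightarrow{f}B\xrightarrow{f'}D$ realizes $\delta$ and $B\xrightarrow{g}C\xrightarrow{g'}F$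 realizes $\delta'$, there are an object $E$, morphisms $h=gf$, $h':C\to E$, $d:D\to E$, $e:E\to F$ with $h'g=df'$, $eh'=g'$, and $\delta''\in\mathbb E(E,A)$ realized by $A\xrightarrow{h}C\xrightarrow{h'}E$, such that $D\xrightarrow{d}E\xrightarrow{e}F$ realizes $f'_*\delta'$, $d^*\delta''=\delta$, $f_*\delta''=e^*\delta'$; (ET4)$^{op}$ the dual. If $A\xrightarrow{x}B\xrightarrow{y}C$ realizes $\delta$, then $x$ is called an inflation, $y$ a deflation, and $A\xrightarrow{x}B\xrightarrow{y}C\overset{\delta}{\dashrightarrow}$ an $\mathbb E$-triangle; it is split if $\delta=0$. Condition (WIC): if $gf$ is an inflation then so is $f$; if $gf$ is a deflation then so is $g$. Proper class. A class $\xi$ of $\mathbb E$-triangles closed under isomorphisms is proper if: (1) it is closed under finite coproducts and contains all split $\mathbb E$-triangles; (2) it is closed under base change (triangles realizing $c^*\delta$) and cobase change (triangles realizing $a_*\delta$); (3) it is saturated: given $\mathbb E$-triangles $A_i\to B_i\xrightarrow{y_i}C\overset{\delta_i}{\dashrightarrow}$ ($i=1,2$), if the second one and the $\mathbb E$-triangle $A_1\to L\to B_2\overset{y_2^*\delta_1}{\dashrightarrow}$ are in $\xi$, then the first one is in $\xi$. $I$ is $\xi$-injective ($I\in\mathcal I(\xi)$) if for each $\mathbb E$-triangle $A\to B\to C\dashrightarrow$ in $\xi$ the sequence $0\to\mathcal C(C,I)\to\mathcal C(B,I)\to\mathcal C(A,I)\to0$ is exact; $\xi$-projective is dual. Enough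 $\xi$-injectives: for each $A$ there is $A\to I\to K\dashrightarrow$ in $\xi$ with $I\in\mathcal I(\xi)$; enough $\xi$-projectives is dual. $Q$ is quasi-$\xi$-injective ($Q\in\mathcal{QI}(\xi)$) if for each $\mathbb E$-triangle $A\to Q\to B\dashrightarrow$ in $\xi$ the sequence $0\to\mathcal C(B,Q)\to\mathcal C(Q,Q)\to\mathcal C(A,Q)\to0$ is exact. An $\mathbb E$-triangle $A\to B\to C\dashrightarrow$ is $\mathcal C(\mathcal{QI}(\xi),-)$-exact if $0\to\mathcal C(Q,A)\to\mathcal C(Q,B)\to\mathcal C(Q,C)\to0$ is exact for all $Q\in\mathcal{QI}(\xi)$. A complex $\cdots\to X_1\xrightarrow{d_1}X_0\xrightarrow{d_0}X_{-1}\to\cdots$ is $\xi$-exact if for each $n$ there is an $\mathbb E$-triangle $K_{n+1}\xrightarrow{g_n}X_n\xrightarrow{f_n}K_n\dashrightarrow$ in $\xi$ with $d_n=g_{n-1}f_n$ (its $\xi$-resolution $\mathbb E$-triangles); it is $\mathcal C(\mathcal{QI}(\xi),-)$-exact if moreover these $\mathbb E$-triangles are $\mathcal C(\mathcal{QI}(\xi),-)$-exact. A bounded sequence $M\to G_0\to\cdots\to G_{-n}$ is $\xi$-exact if it splices from $\mathbb E$-triangles $L_j\to G_{-j}\to L_{j+1}\dashrightarrow$ in $\xi$, $0\le j\le n-1$, with $L_0=M$, $L_n=G_{-n}$. An object is quasi-$\xi$-Gorenstein injective (in $\mathcal{QGI}(\xi)$) if it is one of the objects $K_n$ for some $\mathcal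 C(\mathcal{QI}(\xi),-)$-exact complex all of whose terms are $\xi$-injective. Cohomology. A $\xi$-injective coresolution of $B$ is a $\xi$-exact complex $0\to B\to I_0\to I_{-1}\to\cdots$ with all $I_{-n}\in\mathcal I(\xi)$; $\xi\mathrm{xt}^n_\xi(A,B)$ ($n\ge0$) is the $n$-th cohomology of the complex $\mathcal C(A,I_0)\to\mathcal C(A,I_{-1})\to\cdots$ (independent of the coresolution, and isomorphic to the group computed from a $\xi$-projective resolution of $A$). Quasi-$\xi$-Gorenstein injective dimension. $\xi\text{-}\mathcal{QG}\mathrm{id}(0)=-1$; $\xi\text{-}\mathcal{QG}\mathrm{id}(A)=0$ for nonzero $A\in\mathcal{QGI}(\xi)$; inductively, for $n>0$, $\xi\text{-}\mathcal{QG}\mathrm{id}(A)\le n$ if there is an $\mathbb E$-triangle $A\to G\to K\dashrightarrow$ in $\xi$ with $G\in\mathcal{QGI}(\xi)$ and $\xi\text{-}\mathcal{QG}\mathrm{id}(K)\le n-1$. It equals $n$ if it is $\le n$ but not $\le n-1$, and is $\infty$ if no such $n$ exists.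
   Formalization: In the last formula the supremum is taken in the natural numbers (empty set gives 0) for nonzero M; for zero M the formal theorem instead states that the dimension is −1 and the set is empty, since no single value of sup of the empty set makes the printed formula true. *)

(* Defs.v *)
From HB Require Import structures.
From mathcomp Require Import all_boot all_order all_algebra.
From mathcomp Require Import boolp.

Set Implicit Arguments.
Unset Strict Implicit.
Unset Printing Implicit Defensive.

Import GRing.Theory.

Local Open Scope ring_scope.

Reserved Notation "g ∘ f" (at level 40, left associativity).

Definition short_exact (U V W : zmodType) (f : U -> V) (g : V -> W) : Prop :=
  [/\ injective f,
      forall v, g v = 0 <-> exists u, f u = v
    & forall w, exists v, g v = w].

Section Cohomology.
Variables (U V W : zmodType) (f : {additive U -> V}) (g : {additive V -> W}).

Definition cocycle (v : V) : bool := g v == 0.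

Fact cocycle_closed : zmod_closed cocycle.
Proof.
split=> [|x y]; rewrite !unfold_in /cocycle; first by rewrite raddf0.
by move=> /eqP gx /eqP gy; rewrite raddfB gx gy subr0.
Qed.

HB.instance Definition _ := GRing.isZmodClosed.Build V cocycle cocycle_closed.

Definition cocycles : Type := {v : V | cocycle v}.
HB.instance Definition _ := SubChoice.on cocycles.
HB.instance Definition _ := [SubChoice_isSubZmodule of cocycles by <:].

Definition coboundary (z : cocycles) : bool := `[< exists u, f u = val z >].

Fact coboundary_closed : zmod_closed coboundary.
Proof.
split=> [|x y]; rewrite !unfold_in /coboundary.
  by apply/asboolP; exists 0; rewrite !raddf0.
move=> /asboolP[u fu] /asboolP[v fv]; apply/asboolP.
by exists (u - v); rewrite !raddfB /= fu fv.
Qed.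

HB.instance Definition _ :=
  GRing.isZmodClosed.Build cocycles coboundary coboundary_closed.

(* [Ker g / (Im f ∩ Ker g)], the usual cohomology at [V] when [g \o f = 0] *)
Definition cohomology : zmodType :=
  Quotient.quot (GRing.ZmodClosed.clone _ coboundary _).

End Cohomology.

Record additiveCat := AdditiveCat {
  obj :> Type;
  mor : obj -> obj -> zmodType;
  idm : forall A, mor A A;
  compm : forall A B C, mor B C -> mor A B -> mor A C;
  compA : forall A B C D (h : mor C D) (g : mor B C) (f : mor A B),
    compm h (compm g f) = compm (compm h g) f;
  comp1m : forall A B (f : mor A B), compm (idm B) f = f;
  compm1 : forall A B (f : mor A B), compm f (idm A) = f;
  compDl : forall A B C (g g' : mor B C) (f : mor A B),
    compm (g + g') f = compm g f + compm g' f;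
  compDr : forall A B C (g : mor B C) (f f' : mor A B),
    compm g (f + f') = compm g f + compm g f';
  zero_obj : obj;
  zero_initial : forall A (f : mor zero_obj A), f = 0;
  zero_terminal : forall A (f : mor A zero_obj), f = 0;
  bip : obj -> obj -> obj;
  inl_ : forall A B, mor A (bip A B);
  inr_ : forall A B, mor B (bip A B);
  prl_ : forall A B, mor (bip A B) A;
  prr_ : forall A B, mor (bip A B) B;
  prl_inl : forall A B, compm (prl_ A B) (inl_ A B) = idm A;
  prr_inr : forall A B, compm (prr_ A B) (inr_ A B) = idm B;
  prl_inr : forall A B, compm (prl_ A B) (inr_ A B) = 0;
  prr_inl : forall A B, compm (prr_ A B) (inl_ A B) = 0;
  bip_id : forall A B,
    compm (inl_ A B) (prl_ A B) + compm (inr_ A B) (prr_ A B) = idm (bip A B)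
}.

Arguments mor {a} _ _.
Arguments idm {a} _.
Arguments bip {a} _ _.
Arguments inl_ {a} _ _.
Arguments inr_ {a} _ _.
Arguments prl_ {a} _ _.
Arguments prr_ {a} _ _.
Notation "g ∘ f" := (compm g f).

Section Cat.
Variable C : additiveCat.

Definition is_zero (A : C) : Prop :=
  forall B : C, (forall f : mor A B, f = 0) /\ (forall f : mor B A, f = 0).

Definition is_iso (A B : C) (f : mor A B) : Prop :=
  exists g : mor B A, g ∘ f = idm A /\ f ∘ g = idm B.

Definition bip_map (A A' B B' : C) (f : mor A B) (f' : mor A' B') :
    mor (bip A A') (bip B B') :=
  inl_ B B' ∘ f ∘ prl_ A A' + inr_ B B' ∘ f' ∘ prr_ A A'.

Definition postcomp (X A B : C) (f : mor A B) (u : mor X A) : mor X B := f ∘ u.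
Definition precomp (X A B : C) (f : mor A B) (u : mor B X) : mor A X := u ∘ f.

Fact postcomp_additive (X A B : C) (f : mor A B) :
  zmod_morphism (@postcomp X A B f).
Proof.
move=> u v; apply: (addIr (postcomp f v)).
by rewrite /postcomp -compDr !subrK.
Qed.
HB.instance Definition _ (X A B : C) (f : mor A B) :=
  GRing.isZmodMorphism.Build (mor X A) (mor X B) (@postcomp X A B f)
    (postcomp_additive f).

End Cat.

(* [ext C A] is [E(C, A)], contravariant in [C] and covariant in [A] *)
Record biadditiveFunctor (Cat : additiveCat) := BiadditiveFunctor {
  ext :> Cat -> Cat -> zmodType;
  push : forall (A A' C : Cat), mor A A' -> ext C A -> ext C A';
  pull : forall (A C C' : Cat), mor C' C -> ext C A -> ext C' A;
  push_id : forall A C (d : ext C A), push (idm A) d = d;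
  push_comp : forall A A' A'' C (a' : mor A' A'') (a : mor A A') (d : ext C A),
    push (a' ∘ a) d = push a' (push a d);
  pull_id : forall A C (d : ext C A), pull (idm C) d = d;
  pull_comp : forall A C C' C'' (c : mor C' C) (c' : mor C'' C') (d : ext C A),
    pull (c ∘ c') d = pull c' (pull c d);
  push_pull : forall A A' C C' (a : mor A A') (c : mor C' C) (d : ext C A),
    push a (pull c d) = pull c (push a d);
  pushD : forall A A' C (a : mor A A') (d d' : ext C A),
    push a (d + d') = push a d + push a d';
  pullD : forall A C C' (c : mor C' C) (d d' : ext C A),
    pull c (d + d') = pull c d + pull c d';
  pushDm : forall A A' C (a a' : mor A A') (d : ext C A),
    push (a + a') d = push a d + push a' d;
  pullDm : forall A C C' (c c' : mor C' C) (d : ext C A),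
    pull (c + c') d = pull c d + pull c' d
}.

(* A candidate triangle [A -infl-> B -defl-> C] with an extension in [E(C, A)],
   not yet required to be an E-triangle *)
Record triangle (Cat : additiveCat) (E : biadditiveFunctor Cat) := Tri {
  tA : Cat; tB : Cat; tC : Cat;
  infl : mor tA tB;
  defl : mor tB tC;
  textn : E tC tA
}.
Arguments Tri {Cat E tA tB tC} infl defl textn.

Section Extriangulated.
Variables (Cat : additiveCat) (E : biadditiveFunctor Cat).

Definition ext_sum (A A' C C' : Cat) (d : E C A) (d' : E C' A') :
    E (bip C C') (bip A A') :=
  push (inl_ A A') (pull (prl_ C C') d) + push (inr_ A A') (pull (prr_ C C') d').

Definition tri_sum (T T' : triangle E) : triangle E :=
  Tri (bip_map (infl T) (infl T')) (bip_map (defl T) (defl T'))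
      (ext_sum (textn T) (textn T')).

Definition tri_iso (T T' : triangle E) : Prop :=
  exists (a : mor (tA T) (tA T')) (b : mor (tB T) (tB T'))
         (c : mor (tC T) (tC T')),
    [/\ is_iso a, is_iso b & is_iso c] /\
    [/\ b ∘ infl T = infl T' ∘ a, c ∘ defl T = defl T' ∘ b
      & push a (textn T) = pull c (textn T')].

Definition seq_equiv (A B B' C : Cat) (x : mor A B) (y : mor B C)
    (x' : mor A B') (y' : mor B' C) : Prop :=
  exists b : mor B B', [/\ is_iso b, b ∘ x = x' & y' ∘ b = y].

(* The assignment [s] is given by its graph: [s (Tri x y d)] says that the
   sequence [A -x-> B -y-> C] belongs to the class [s(d)]; an E-triangle is a
   triangle satisfying [s]. *)
Variable s : triangle E -> Prop.

Record realization : Prop := Realization {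
  real_ex : forall (A C : Cat) (d : E C A),
    exists (B : Cat) (x : mor A B) (y : mor B C), s (Tri x y d);
  real_class : forall (A B B' C : Cat) (x : mor A B) (y : mor B C)
      (x' : mor A B') (y' : mor B' C) (d : E C A),
    s (Tri x y d) -> (s (Tri x' y' d) <-> seq_equiv x y x' y');
  real_mor : forall (A B C A' B' C' : Cat)
      (x : mor A B) (y : mor B C) (d : E C A)
      (x' : mor A' B') (y' : mor B' C') (d' : E C' A')
      (a : mor A A') (c : mor C C'),
    s (Tri x y d) -> s (Tri x' y' d') -> push a d = pull c d' ->
    exists b : mor B B', b ∘ x = x' ∘ a /\ c ∘ y = y' ∘ b
}.

Record additive_realization : Prop := AdditiveRealization {
  areal : realization;
  real_zero : forall A C : Cat, s (Tri (inl_ A C) (prr_ A C) (0 : E C A));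
  real_sum : forall T T' : triangle E, s T -> s T' -> s (tri_sum T T')
}.

Definition ET3 : Prop :=
  forall (A B C A' B' C' : Cat)
    (x : mor A B) (y : mor B C) (d : E C A)
    (x' : mor A' B') (y' : mor B' C') (d' : E C' A')
    (a : mor A A') (b : mor B B'),
  s (Tri x y d) -> s (Tri x' y' d') -> b ∘ x = x' ∘ a ->
  exists c : mor C C', c ∘ y = y' ∘ b /\ push a d = pull c d'.

Definition ET3op : Prop :=
  forall (A B C A' B' C' : Cat)
    (x : mor A B) (y : mor B C) (d : E C A)
    (x' : mor A' B') (y' : mor B' C') (d' : E C' A')
    (b : mor B B') (c : mor C C'),
  s (Tri x y d) -> s (Tri x' y' d') -> c ∘ y = y' ∘ b ->
  exists a : mor A A', b ∘ x = x' ∘ a /\ push a d = pull c d'.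

Definition ET4 : Prop :=
  forall (A B C D F : Cat)
    (f : mor A B) (f' : mor B D) (d1 : E D A)
    (g : mor B C) (g' : mor C F) (d2 : E F B),
  s (Tri f f' d1) -> s (Tri g g' d2) ->
  exists (X : Cat) (h' : mor C X) (d : mor D X) (e : mor X F) (d3 : E X A),
    [/\ h' ∘ g = d ∘ f', e ∘ h' = g', s (Tri (g ∘ f) h' d3)
      & s (Tri d e (push f' d2))] /\
    (pull d d3 = d1 /\ push f d3 = pull e d2).

Definition ET4op : Prop :=
  forall (A B C D F : Cat)
    (f' : mor D A) (f : mor A B) (d1 : E B D)
    (g' : mor F B) (g : mor B C) (d2 : E C F),
  s (Tri f' f d1) -> s (Tri g' g d2) ->
  exists (X : Cat) (h' : mor X A) (d : mor D X) (e : mor X F) (d3 : E C X),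
    [/\ f ∘ h' = g' ∘ e, h' ∘ d = f', s (Tri h' (g ∘ f) d3)
      & s (Tri d e (pull g' d1))] /\
    (push e d3 = d2 /\ push d d1 = pull g d3).

(* (ET1), the biadditivity of [E], is part of [biadditiveFunctor]. *)
Record extriangulated : Prop := Extriangulated {
  extri_real : additive_realization;
  extri_ET3 : ET3;
  extri_ET3op : ET3op;
  extri_ET4 : ET4;
  extri_ET4op : ET4op
}.

Definition inflation (A B : Cat) (x : mor A B) : Prop :=
  exists (C : Cat) (y : mor B C) (d : E C A), s (Tri x y d).

Definition deflation (B C : Cat) (y : mor B C) : Prop :=
  exists (A : Cat) (x : mor A B) (d : E C A), s (Tri x y d).

Definition WIC : Prop :=
  forall (A B C : Cat) (f : mor A B) (g : mor B C),
    (inflation (g ∘ f) -> inflation f) /\ (deflation (g ∘ f) -> deflation g).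

Variable xi : triangle E -> Prop.

Record proper_class : Prop := ProperClass {
  xi_etri : forall T, xi T -> s T;
  xi_iso : forall T T', xi T -> s T' -> tri_iso T T' -> xi T';
  xi_sum : forall T T', xi T -> xi T' -> xi (tri_sum T T');
  xi_split : forall (A B C : Cat) (x : mor A B) (y : mor B C),
    s (Tri x y (0 : E C A)) -> xi (Tri x y (0 : E C A));
  xi_base : forall (A B C B' C' : Cat) (x : mor A B) (y : mor B C) (d : E C A)
      (c : mor C' C) (x' : mor A B') (y' : mor B' C'),
    xi (Tri x y d) -> s (Tri x' y' (pull c d)) -> xi (Tri x' y' (pull c d));
  xi_cobase : forall (A B C A' B' : Cat) (x : mor A B) (y : mor B C) (d : E C A)
      (a : mor A A') (x' : mor A' B') (y' : mor B' C),
    xi (Tri x y d) -> s (Tri x' y' (push a d)) -> xi (Tri x' y' (push a d));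
  xi_saturated : forall (A1 B1 A2 B2 C L : Cat)
      (x1 : mor A1 B1) (y1 : mor B1 C) (d1 : E C A1)
      (x2 : mor A2 B2) (y2 : mor B2 C) (d2 : E C A2)
      (l : mor A1 L) (m : mor L B2),
    s (Tri x1 y1 d1) -> xi (Tri x2 y2 d2) -> xi (Tri l m (pull y2 d1)) ->
    xi (Tri x1 y1 d1)
}.

Definition contra_exact (X : Cat) (T : triangle E) : Prop :=
  short_exact (@precomp Cat X _ _ (defl T)) (@precomp Cat X _ _ (infl T)).

Definition co_exact (X : Cat) (T : triangle E) : Prop :=
  short_exact (@postcomp Cat X _ _ (infl T)) (@postcomp Cat X _ _ (defl T)).

Definition injective_obj (I : Cat) : Prop := forall T, xi T -> contra_exact I T.

Definition projective_obj (P : Cat) : Prop := forall T, xi T -> co_exact P T.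

Definition enough_injectives : Prop :=
  forall A : Cat, exists (I K : Cat) (x : mor A I) (y : mor I K) (d : E K A),
    injective_obj I /\ xi (Tri x y d).

Definition enough_projectives : Prop :=
  forall A : Cat, exists (K P : Cat) (x : mor K P) (y : mor P A) (d : E A K),
    projective_obj P /\ xi (Tri x y d).

Definition quasi_injective (Q : Cat) : Prop :=
  forall (A B : Cat) (x : mor A Q) (y : mor Q B) (d : E B A),
    xi (Tri x y d) -> contra_exact Q (Tri x y d).

Definition QI_exact (T : triangle E) : Prop :=
  forall Q, quasi_injective Q -> co_exact Q T.

(* [cdiff X n : X (n + 1) -> X n] is the differential usually written
   [d_(n+1)]; indexing it by its target lets both ends typecheck. *)
Record complex := Complex {
  cterm :> int -> Cat;
  cdiff : forall n : int, mor (cterm (n + 1)) (cterm n);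
  cdiff2 : forall n : int, cdiff n ∘ cdiff (n + 1) = 0
}.

Record xi_resolution (X : complex) := XiResolution {
  syz : int -> Cat;
  syz_in : forall n : int, mor (syz (n + 1)) (X n);
  syz_out : forall n : int, mor (X n) (syz n);
  syz_ext : forall n : int, E (syz n) (syz (n + 1));
  syz_xi : forall n : int, xi (Tri (syz_in n) (syz_out n) (syz_ext n));
  syz_diff : forall n : int, cdiff X n = syz_in n ∘ syz_out (n + 1)
}.

Definition QGI (A : Cat) : Prop :=
  exists (X : complex) (K : xi_resolution X),
    [/\ forall n, injective_obj (X n),
        forall n, QI_exact (Tri (syz_in K n) (syz_out K n) (syz_ext K n))
      & exists n, syz K n = A].

(* [M -> G 0 -> ... -> G n], spliced from [L j -> G j -> L (j + 1)] *)
Definition xi_exact_sequence (M : Cat) (n : nat) (G : nat -> Cat) : Prop :=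
  exists L : nat -> Cat,
    [/\ L 0%N = M, L n = G n
      & forall j, (j < n)%N ->
          exists (x : mor (L j) (G j)) (y : mor (G j) (L j.+1))
                 (d : E (L j.+1) (L j)), xi (Tri x y d)].

(* Coresolutions are indexed cohomologically: [cor_term n] is the term usually
   written [I_(-n)], and [cosyz B K n] is its source syzygy, with [B] itself at
   [n = 0]. *)
Definition cosyz (B : Cat) (K : nat -> Cat) (n : nat) : Cat :=
  if n is m.+1 then K m else B.

Record coresolution (B : Cat) := Coresolution {
  cor_term : nat -> Cat;
  cor_syz : nat -> Cat;
  cor_in : forall n, mor (cosyz B cor_syz n) (cor_term n);
  cor_out : forall n, mor (cor_term n) (cosyz B cor_syz n.+1);
  cor_ext : forall n, E (cosyz B cor_syz n.+1) (cosyz B cor_syz n);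
  cor_xi : forall n, xi (Tri (cor_in n) (cor_out n) (cor_ext n));
  cor_inj : forall n, injective_obj (cor_term n)
}.

Definition cor_diff (B : Cat) (R : coresolution B) (n : nat) :
    mor (cor_term R n) (cor_term R n.+1) :=
  cor_in R n.+1 ∘ cor_out R n.

(* The complex starts at [C(A, I_0)], so the differential into degree 0 is 0. *)
Definition xixt (A B : Cat) (R : coresolution B) (n : nat) : zmodType :=
  match n with
  | 0%N => cohomology
      (\0 : {additive mor A (cor_term R 0) -> mor A (cor_term R 0)})
      (@postcomp Cat A _ _ (cor_diff R 0))
  | m.+1 => cohomology
      (@postcomp Cat A _ _ (cor_diff R m))
      (@postcomp Cat A _ _ (cor_diff R m.+1))
  end.

(* The group does not depend on the coresolution up to isomorphism, so its
   vanishing is asked for every choice; coresolutions exist as soon as there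
   are enough injectives. *)
Definition xixt_zero (n : nat) (A B : Cat) : Prop :=
  forall (R : coresolution B) (u : xixt A R n), u = 0.

(* The value is [-1] on zero objects and [0] on nonzero objects of [QGI], which
   gives the bounds in the first two constructors. *)
Inductive QGid_le : int -> Cat -> Prop :=
| QGid_le_zero (n : int) (A : Cat) :
    -1 <= n -> is_zero A -> QGid_le n A
| QGid_le_QGI (n : int) (A : Cat) :
    0 <= n -> QGI A -> QGid_le n A
| QGid_le_step (n : int) (A G K : Cat) (x : mor A G) (y : mor G K) (d : E K A) :
    0 < n -> xi (Tri x y d) -> QGI G -> QGid_le (n - 1) K -> QGid_le n A.

Definition QGid_eq (A : Cat) (n : int) : Prop :=
  QGid_le n A /\ ~ QGid_le (n - 1) A.

Definition QGid_finite (A : Cat) : Prop := exists n : int, QGid_le n A.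

End Extriangulated.

(* The supremum in the ordered set of natural numbers; the empty set has
   supremum [0]. *)
Definition nat_sup (S : nat -> Prop) (d : nat) : Prop :=
  (forall m, S m -> (m <= d)%N) /\
  (forall e, (forall m, S m -> (m <= e)%N) -> (d <= e)%N).

(* Main.v *)
(* Call A rigid if, for every quasi-injective Q, the xi-extensions in E(Q, A)
   vanish and xi-inflations out of A induce monomorphisms on C(Q, -). The
   quasi-Gorenstein injectives are the largest class of rigid objects in which
   every object has a syzygy and a cosyzygy, relative to xi-triangles with
   injective middle term, inside the class. By coinduction they are closed under
   extensions and under cancellation of injective summands, so a finite
   dimension drops along injective cosyzygies, and high cosyzygies are rigid,
   which gives the vanishing of cohomology.

   Conversely, dimension shifting reduces to a triangle M -> I -> K with I
   injective, K quasi-Gorenstein injective and xixt^1(-, M) = 0 on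
   quasi-injectives; comparing it with K' -> J -> K as in Schanuel's lemma makes
   M a complement of J in an object of the class. For (3), the non-injective term
   is moved to the front by pulling back M -> I -> K along an object of finite
   injective dimension. *)
Require Import Defs.
From mathcomp Require Import all_boot all_order all_algebra.
From mathcomp Require Import generic_quotient boolp zify.

Set Implicit Arguments.
Unset Strict Implicit.
Unset Printing Implicit Defensive.

Import Order.TTheory GRing.Theory Num.Theory.

Local Open Scope ring_scope.

Local Notation compA := Defs.compA.

(** * Vanishing of cohomology as exactness at the middle term *)

Lemma cohomology_eq0P (U V W : zmodType) (f : {additive U -> V})
    (g : {additive V -> W}) :
  (forall u : cohomology f g, u = 0) <->
  (forall v, g v = 0 -> exists u, f u = v).
Proof.
have piE (z : cocycles g) :
    \pi_(cohomology f g)%qT z = 0 <-> exists u, f u = val z.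
  rewrite -(raddf0 \pi_(cohomology f g)%qT); split.
    move/eqP; rewrite -Quotient.idealrBE subr0.
    by rewrite unfold_in => /asboolP.
  move=> H; apply/eqP; rewrite -Quotient.idealrBE subr0.
  by rewrite unfold_in; apply/asboolP.
split=> [H v gv|H u].
  have zP : cocycle g v by apply/eqP.
  exact: (piE (exist _ v zP)).1 (H _).
rewrite -[u]reprK; apply/piE; apply: H.
exact/eqP/(valP (repr u)).
Qed.

(** * Calculus in additive categories and biadditive functors *)

Section AdditiveCategory.
Variable Cat : additiveCat.

Lemma comp0m (A B D : Cat) (f : mor A B) : (0 : mor B D) ∘ f = 0.
Proof. by apply: (addIr (0 ∘ f)); rewrite -compDl !add0r. Qed.

Lemma compm0 (A B D : Cat) (g : mor B D) : g ∘ (0 : mor A B) = 0.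
Proof. by apply: (addIr (g ∘ 0)); rewrite -compDr !add0r. Qed.

Lemma compBl (A B D : Cat) (g g' : mor B D) (f : mor A B) :
  (g - g') ∘ f = g ∘ f - g' ∘ f.
Proof. by apply: (addIr (g' ∘ f)); rewrite -compDl !subrK. Qed.

Lemma compBr (A B D : Cat) (g : mor B D) (f f' : mor A B) :
  g ∘ (f - f') = g ∘ f - g ∘ f'.
Proof. by apply: (addIr (g ∘ f')); rewrite -compDr !subrK. Qed.

Lemma is_iso_id (A : Cat) : is_iso (idm A).
Proof. by exists (idm A); rewrite comp1m. Qed.

Lemma is_iso_two_sided (A B : Cat) (f : mor A B) (l r : mor B A) :
  l ∘ f = idm A -> f ∘ r = idm B -> is_iso f.
Proof.
move=> lf fr; have lr : l = r by rewrite -(compm1 l) -fr compA lf comp1m.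
by exists l; split=> //; rewrite lr.
Qed.

Lemma inl_prl_zero_obj (A : Cat) :
  inl_ A (zero_obj Cat) ∘ prl_ A (zero_obj Cat) = idm _.
Proof.
by rewrite -bip_id (zero_initial (inr_ _ _)) comp0m addr0.
Qed.

Lemma inr_prr_zero_obj (A : Cat) :
  inr_ (zero_obj Cat) A ∘ prr_ (zero_obj Cat) A = idm _.
Proof.
by rewrite -bip_id (zero_initial (inl_ _ _)) comp0m add0r.
Qed.

Definition bip_swap (A B : Cat) : mor (bip A B) (bip B A) :=
  inl_ B A ∘ prr_ A B + inr_ B A ∘ prl_ A B.

Lemma bip_swap_inl (A B : Cat) : bip_swap A B ∘ inl_ A B = inr_ B A.
Proof. by rewrite compDl -!compA prl_inl prr_inl compm0 compm1 add0r. Qed.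

Lemma bip_swap_inr (A B : Cat) : bip_swap A B ∘ inr_ A B = inl_ B A.
Proof. by rewrite compDl -!compA prl_inr prr_inr compm0 compm1 addr0. Qed.

Lemma bip_swapK (A B : Cat) : bip_swap B A ∘ bip_swap A B = idm _.
Proof.
by rewrite [X in _ ∘ X = _]/bip_swap compDr !compA bip_swap_inl bip_swap_inr
  addrC bip_id.
Qed.

Variable E : biadditiveFunctor Cat.

Lemma push0 (A A' D : Cat) (a : mor A A') : push a (0 : E D A) = 0.
Proof. by apply: (addIr (push a (0 : E D A))); rewrite -pushD !add0r. Qed.

Lemma pull0 (A D D' : Cat) (c : mor D' D) : pull c (0 : E D A) = 0.
Proof. by apply: (addIr (pull c (0 : E D A))); rewrite -pullD !add0r. Qed.

Lemma push0m (A A' D : Cat) (d : E D A) : push (0 : mor A A') d = 0.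
Proof. by apply: (addIr (push (0 : mor A A') d)); rewrite -pushDm !add0r. Qed.

Lemma pull0m (A D D' : Cat) (d : E D A) : pull (0 : mor D' D) d = 0.
Proof. by apply: (addIr (pull (0 : mor D' D) d)); rewrite -pullDm !add0r. Qed.

End AdditiveCategory.

(** * Exactness, isomorphisms and base change for E-triangles *)

Section Extriangulated.
Variables (Cat : additiveCat) (E : biadditiveFunctor Cat).
Variable s : triangle E -> Prop.
Hypothesis extri : extriangulated s.

Let s_real : realization s := areal (extri_real extri).
Let s_zero := real_zero (extri_real extri).
Let et3 := extri_ET3 extri.
Let et3op := extri_ET3op extri.

Section ExactSequences.
Variables (A B D : Cat) (x : mor A B) (y : mor B D) (d : E D A).
Hypothesis sT : s (Tri x y d).

(** Comparison with the split triangle on [A] and the zero object factors [y ∘ x] through zero. The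
    lemmas up to [infl_extend] compare with split triangles in the same way. *)
Lemma defl_infl : y ∘ x = 0.
Proof.
have [|c [e _]] := et3 (s_zero A (zero_obj Cat)) sT
  (a := idm A) (b := x ∘ prl_ _ _).
  by rewrite -compA prl_inl compm1.
by rewrite -[x](compm1) -(prl_inl A (zero_obj Cat)) (compA x) compA -e
  (zero_initial c) !comp0m.
Qed.

Lemma push_infl : push x d = 0.
Proof.
have [|c [_ ->]] := et3 sT (s_zero B (zero_obj Cat)) (a := x) (b := inl_ _ _).
  by [].
by rewrite pull0.
Qed.

Lemma pull_defl : pull y d = 0.
Proof.
have [|a [_ <-]] := et3op (s_zero (zero_obj Cat) B) sT
  (b := prr_ _ _) (c := y).
  by [].
by rewrite push0.
Qed.

Lemma infl_factor (X : Cat) (f : mor X B) : y ∘ f = 0 -> exists u, f = x ∘ u.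
Proof.
move=> yf; have [|a [e _]] := et3op (s_zero X (zero_obj Cat)) sT
  (b := f ∘ prl_ _ _) (c := 0).
  by rewrite compA yf !comp0m.
by exists a; rewrite -e -compA prl_inl compm1.
Qed.

Lemma defl_factor (X : Cat) (f : mor B X) : f ∘ x = 0 -> exists u, f = u ∘ y.
Proof.
move=> fx; have [|c [e _]] := et3 sT (s_zero (zero_obj Cat) X)
  (b := inr_ _ _ ∘ f) (a := 0).
  by rewrite -compA fx !compm0.
by exists c; rewrite e compA prr_inr comp1m.
Qed.

Lemma defl_lift (X : Cat) (f : mor X D) : pull f d = 0 -> exists u, y ∘ u = f.
Proof.
move=> fd.
have [|b [_ e]] := real_mor s_real (s_zero A X) sT (a := idm A) (c := f).
  by rewrite push_id fd.
by exists (b ∘ inr_ _ _); rewrite compA -e -compA prr_inr compm1.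
Qed.

Lemma infl_extend (X : Cat) (f : mor A X) : push f d = 0 -> exists u, u ∘ x = f.
Proof.
move=> fd.
have [|b [e _]] := real_mor s_real sT (s_zero X D) (a := f) (c := idm D).
  by rewrite pull_id fd.
by exists (prl_ _ _ ∘ b); rewrite -compA e compA prl_inl comp1m.
Qed.

(** Exactness of C(W, D) → E(W, A) → E(W, B): as [push x h] vanishes, [x] extends along the
    inflation of a realization of [h], and the third component of the resulting morphism of
    triangles is [w]. *)
Lemma push_infl_eq0 (W : Cat) (h : E W A) :
  push x h = 0 -> exists w : mor W D, h = pull w d.
Proof.
move=> xh; have [Z [u [v sZ]]] := real_ex s_real h.
have [k kx] : exists k : mor Z B, k ∘ u = x.
  have [|b [e1 e2]] := real_mor s_real sZ (s_zero B W) (a := x) (c := idm W).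
    by rewrite xh pull0.
  by exists (prl_ _ _ ∘ b); rewrite -compA e1 compA prl_inl comp1m.
have [|w [_]] := et3 sZ sT (a := idm A) (b := k); first by rewrite kx compm1.
by rewrite push_id => ->; exists w.
Qed.

(* [b - 1] factors through [y] and is killed by it, so [(b - 1)^2 = 0]. *)
Lemma endo_iso (b : mor B B) : b ∘ x = x -> y ∘ b = y -> is_iso b.
Proof.
move=> bx yb; have [|u eu] := defl_factor (f := b - idm B).
  by rewrite compBl comp1m bx subrr.
have nn : (b - idm B) ∘ (b - idm B) = 0.
  by rewrite [X in X ∘ _]eu -compA compBr yb compm1 subrr compm0.
have e : b ∘ b = b + b - idm B.
  move: nn; rewrite compBl comp1m compBr compm1 => /eqP.
  by rewrite subr_eq0 => /eqP/(canRL (subrK _)) ->; rewrite addrAC.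
exists (idm B - (b - idm B)).
by rewrite !compBl !compBr !comp1m !compm1 e (addrAC (b + b)) addrK opprB
  addrC subrK.
Qed.

End ExactSequences.

(** The inverses of [a] and [c] lift to some [b'], which need not invert [b]; but [b' ∘ b] and
    [b ∘ b'] are compatible with the identities of the ends, so both are invertible by
    [endo_iso]. *)
Lemma mid_iso (A B D A' B' D' : Cat)
    (x : mor A B) (y : mor B D) (d : E D A)
    (x' : mor A' B') (y' : mor B' D') (d' : E D' A')
    (a : mor A A') (b : mor B B') (c : mor D D') :
  s (Tri x y d) -> s (Tri x' y' d') -> is_iso a -> is_iso c ->
  b ∘ x = x' ∘ a -> c ∘ y = y' ∘ b -> push a d = pull c d' -> is_iso b.
Proof.
move=> sT sT' [a' [a'a aa']] [c' [c'c cc']] bx cy adc.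
have [|b' [b'x' c'y']] := real_mor s_real sT' sT (a := a') (c := c').
  by rewrite -[d'](pull_id) -cc' pull_comp -adc push_pull -push_comp a'a push_id.
have [g [gb _]] : is_iso (b' ∘ b).
  apply: (endo_iso sT).
    by rewrite -compA bx compA b'x' -compA a'a compm1.
  by rewrite compA -c'y' -compA -cy compA c'c comp1m.
have [h [_ bh]] : is_iso (b ∘ b').
  apply: (endo_iso sT').
    by rewrite -compA b'x' compA bx -compA aa' compm1.
  by rewrite compA -cy -compA -c'y' compA cc' comp1m.
apply: (is_iso_two_sided (l := g ∘ b') (r := b' ∘ h)).
  by rewrite -compA.
by rewrite compA.
Qed.

Lemma etri_iso_right (A B D D' : Cat) (x : mor A B) (y : mor B D)
    (c : mor D D') (d : E D' A) :
  is_iso c -> s (Tri x y (pull c d)) -> s (Tri x (c ∘ y) d).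
Proof.
move=> ci sT; have [B' [x' [y' sT']]] := real_ex s_real d.
have [|b [bx cy]] := real_mor s_real sT sT' (a := idm A) (c := c).
  by rewrite push_id.
have [b' [b'b bb']] := mid_iso sT sT' (is_iso_id A) ci bx cy (push_id _).
apply/(real_class s_real _ _ sT'); exists b'; split; first by exists b.
  by rewrite -[x'](compm1) -bx compA b'b comp1m.
by rewrite cy -compA bb' compm1.
Qed.

Lemma etri_iso_left (A A' B D : Cat) (x : mor A' B) (y : mor B D)
    (a : mor A A') (d : E D A) :
  is_iso a -> s (Tri x y (push a d)) -> s (Tri (x ∘ a) y d).
Proof.
move=> ai sT; have [B' [x' [y' sT']]] := real_ex s_real d.
have [|b [bx yb]] := real_mor s_real sT' sT (a := a) (c := idm D).
  by rewrite pull_id.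
apply/(real_class s_real _ _ sT'); exists b; split=> //.
  by apply: (mid_iso sT' sT ai (is_iso_id D) bx yb); rewrite pull_id.
by rewrite -yb comp1m.
Qed.

Lemma etri_inr_prl (A D : Cat) : s (Tri (inr_ A D) (prl_ A D) (0 : E A D)).
Proof.
apply/(real_class s_real _ _ (s_zero D A)); exists (bip_swap D A); split.
- by exists (bip_swap A D); rewrite !bip_swapK.
- exact: bip_swap_inl.
by rewrite compDr !compA prl_inr prl_inl comp0m comp1m addr0.
Qed.

(* A triangle with zero extension is a biproduct decomposition of [B], hence
   its two ends can be exchanged. *)
Lemma etri_split_swap (A B D : Cat) (x : mor A B) (y : mor B D) :
  s (Tri x y (0 : E D A)) ->
  exists (x' : mor D B) (y' : mor B A), s (Tri x' y' (0 : E A D)).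
Proof.
move=> sT.
have [b [bi bx yb]] := (real_class s_real x y (s_zero A D)).1 sT.
exists (b ∘ inr_ A D).
have [b' [b'b bb']] := bi; exists (prl_ A D ∘ b').
apply/(real_class s_real _ _ (etri_inr_prl A D)); exists b; split=> //.
by rewrite -compA b'b compm1.
Qed.

Lemma etri_idm_0 (A : Cat) :
  s (Tri (idm A) (0 : mor A (zero_obj Cat)) (0 : E _ _)).
Proof.
apply/(real_class s_real _ _ (s_zero A (zero_obj Cat))); exists (prl_ _ _).
split; [|exact: prl_inl|by rewrite (zero_terminal (prr_ _ _)) comp0m].
by exists (inl_ _ _); rewrite prl_inl inl_prl_zero_obj.
Qed.

Lemma etri_0_idm (A : Cat) :
  s (Tri (0 : mor (zero_obj Cat) A) (idm A) (0 : E _ _)).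
Proof.
apply/(real_class s_real _ _ (s_zero (zero_obj Cat) A)); exists (prr_ _ _).
split; [|by rewrite (zero_initial (inl_ _ _)) compm0|by rewrite comp1m].
by exists (inr_ _ _); rewrite prr_inr inr_prr_zero_obj.
Qed.

(** ET4 applied to [u ∘ i] gives a cone [X] that is also the middle term of a realization of
    [push q m], so [X] is isomorphic to [B2]. The retraction [p] of [i] identifies the new
    extension. *)
Lemma etri_pullback_half (S A1 A2 L B2 D : Cat) (i : mor A1 S) (q : mor S A2)
    (p : mor S A1) (u : mor S L) (v : mor L D) (m : E D S)
    (x2 : mor A2 B2) (y2 : mor B2 D) :
  s (Tri i q 0) -> p ∘ i = idm A1 -> s (Tri u v m) ->
  s (Tri x2 y2 (push q m)) ->
  exists e : mor L B2, s (Tri (u ∘ i) e (pull y2 (push p m))).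
Proof.
move=> sS pi sL sT.
have [X [h [d [e [d3 [[_ _ sh se] [_ id3]]]]]]] := extri_ET4 extri sS sL.
have [b [bi _ yb]] := (real_class s_real _ _ se).1 sT.
exists (b ∘ h); apply: etri_iso_right => //.
rewrite -pull_comp yb -push_pull.
by rewrite -id3 -push_comp pi push_id.
Qed.

(** Both extensions are components of a single [m] in E(D, A1 ⊕ A2). The middle term [L] of its
    realization plays the part of a pullback of [y1] and [y2]. *)
Lemma etri_pullback (A1 B1 A2 B2 D : Cat)
    (x1 : mor A1 B1) (y1 : mor B1 D) (d1 : E D A1)
    (x2 : mor A2 B2) (y2 : mor B2 D) (d2 : E D A2) :
  s (Tri x1 y1 d1) -> s (Tri x2 y2 d2) ->
  exists (L : Cat) (m1 : mor A1 L) (e2 : mor L B2) (m2 : mor A2 L)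
         (e1 : mor L B1),
    s (Tri m1 e2 (pull y2 d1)) /\ s (Tri m2 e1 (pull y1 d2)).
Proof.
move=> sT1 sT2.
pose m := push (inl_ A1 A2) d1 + push (inr_ A1 A2) d2.
have pm : push (prl_ A1 A2) m = d1.
  by rewrite pushD -!push_comp prl_inl prl_inr push_id push0m addr0.
have qm : push (prr_ A1 A2) m = d2.
  by rewrite pushD -!push_comp prr_inr prr_inl push_id push0m add0r.
have [L [u [v sL]]] := real_ex s_real m.
have [|e2 s2] := etri_pullback_half (s_zero A1 A2) (prl_inl A1 A2) sL
  (x2 := x2) (y2 := y2); first by rewrite qm.
have [|e1 s1] := etri_pullback_half (etri_inr_prl A1 A2) (prr_inr A1 A2) sL
  (x2 := x1) (y2 := y1); first by rewrite pm.
by rewrite pm in s2; rewrite qm in s1; exists L, (u ∘ inl_ A1 A2), e2, (u ∘ inr_ A1 A2), e1.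
Qed.

Lemma etri_pushout_half (A S D1 D2 L B1 : Cat) (i : mor D1 S) (q : mor S D2)
    (j : mor D2 S) (u : mor A L) (v : mor L S) (m : E S A)
    (x1 : mor A B1) (y1 : mor B1 D1) :
  s (Tri i q 0) -> q ∘ j = idm D2 -> s (Tri u v m) ->
  s (Tri x1 y1 (pull i m)) ->
  exists e : mor B1 L, s (Tri e (q ∘ v) (push x1 (pull j m))).
Proof.
move=> sS qj sL sT.
have [X [h [d [e [d3 [[_ _ sh se] [_ id3]]]]]]] := extri_ET4op extri sL sS.
have [b [bi bd _]] := (real_class s_real _ _ se).1 sT.
have [b' [b'b bb']] := bi.
exists (h ∘ b'); apply: etri_iso_left; first by exists b.
by rewrite -bd push_comp -push_comp b'b push_id push_pull id3 -pull_comp qj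
  pull_id.
Qed.

(** Dual to [etri_pullback], with [m] in E(D1 ⊕ D2, A). *)
Lemma etri_pushout (A B1 D1 B2 D2 : Cat)
    (x1 : mor A B1) (y1 : mor B1 D1) (d1 : E D1 A)
    (x2 : mor A B2) (y2 : mor B2 D2) (d2 : E D2 A) :
  s (Tri x1 y1 d1) -> s (Tri x2 y2 d2) ->
  exists (L : Cat) (m1 : mor B1 L) (e2 : mor L D2) (m2 : mor B2 L)
         (e1 : mor L D1),
    s (Tri m1 e2 (push x1 d2)) /\ s (Tri m2 e1 (push x2 d1)).
Proof.
move=> sT1 sT2.
pose m := pull (prl_ D1 D2) d1 + pull (prr_ D1 D2) d2.
have pm : pull (inl_ D1 D2) m = d1.
  by rewrite pullD -!pull_comp prl_inl prr_inl pull_id pull0m addr0.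
have qm : pull (inr_ D1 D2) m = d2.
  by rewrite pullD -!pull_comp prr_inr prl_inr pull_id pull0m add0r.
have [L [u [v sL]]] := real_ex s_real m.
have [|e1 s1] := etri_pushout_half (s_zero D1 D2) (prr_inr D1 D2) sL
  (x1 := x1) (y1 := y1); first by rewrite pm.
have [|e2 s2] := etri_pushout_half (etri_inr_prl D1 D2) (prl_inl D1 D2) sL
  (x1 := x2) (y1 := y2); first by rewrite qm.
by rewrite qm in s1; rewrite pm in s2; exists L, e1, (prr_ D1 D2 ∘ v), e2, (prl_ D1 D2 ∘ v).
Qed.

(** * Base change, cobase change and octahedra inside the proper class *)

Variable xi : triangle E -> Prop.
Hypothesis proper_xi : proper_class s xi.

Definition xi_ext (A D : Cat) (d : E D A) : Prop :=
  exists (B : Cat) (x : mor A B) (y : mor B D), xi (Tri x y d).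

Let xi_s := xi_etri proper_xi.

(** Base change along the identity carries membership in [xi] from one realization to any other, so
    it depends only on the extension. *)
Lemma xi_ext_tri (A B D : Cat) (x : mor A B) (y : mor B D) (d : E D A) :
  xi_ext d -> s (Tri x y d) -> xi (Tri x y d).
Proof.
move=> [B' [x' [y' xT]]] sT.
by have := xi_base proper_xi xT (c := idm D) (x' := x) (y' := y);
  rewrite pull_id; apply.
Qed.

Lemma xi_ext_real (A D : Cat) (d : E D A) :
  (forall (B : Cat) (x : mor A B) (y : mor B D),
    s (Tri x y d) -> xi (Tri x y d)) -> xi_ext d.
Proof.
by move=> H; have [B [x [y sT]]] := real_ex s_real d; exists B, x, y; apply: H.
Qed.

Lemma xi_ext_pull (A D D' : Cat) (c : mor D' D) (d : E D A) :
  xi_ext d -> xi_ext (pull c d).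
Proof.
move=> [B [x [y xT]]]; apply: xi_ext_real => B' x' y' sT.
exact: (xi_base proper_xi xT sT).
Qed.

Lemma xi_ext_push (A A' D : Cat) (a : mor A A') (d : E D A) :
  xi_ext d -> xi_ext (push a d).
Proof.
move=> [B [x [y xT]]]; apply: xi_ext_real => B' x' y' sT.
exact: (xi_cobase proper_xi xT sT).
Qed.

Lemma xi_tri_ext (A B D : Cat) (x : mor A B) (y : mor B D) (d : E D A) :
  xi (Tri x y d) -> xi_ext d.
Proof. by exists B, x, y. Qed.

Lemma xi_idm_0 (A : Cat) :
  xi (Tri (idm A) (0 : mor A (zero_obj Cat)) (0 : E _ _)).
Proof. exact: (xi_split proper_xi (etri_idm_0 A)). Qed.

Lemma xi_0_idm (A : Cat) :
  xi (Tri (0 : mor (zero_obj Cat) A) (idm A) (0 : E _ _)).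
Proof. exact: (xi_split proper_xi (etri_0_idm A)). Qed.

Lemma xi_pullback (A1 B1 A2 B2 D : Cat)
    (x1 : mor A1 B1) (y1 : mor B1 D) (d1 : E D A1)
    (x2 : mor A2 B2) (y2 : mor B2 D) (d2 : E D A2) :
  xi (Tri x1 y1 d1) -> xi (Tri x2 y2 d2) ->
  exists (L : Cat) (m1 : mor A1 L) (e2 : mor L B2) (m2 : mor A2 L)
         (e1 : mor L B1),
    xi (Tri m1 e2 (pull y2 d1)) /\ xi (Tri m2 e1 (pull y1 d2)).
Proof.
move=> xT1 xT2.
have [L [m1 [e2 [m2 [e1 [s1 s2]]]]]] := etri_pullback (xi_s xT1) (xi_s xT2).
exists L, m1, e2, m2, e1.
by split; apply: xi_ext_tri => //; apply: xi_ext_pull; apply: xi_tri_ext;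
  eassumption.
Qed.

Lemma xi_pushout (A B1 D1 B2 D2 : Cat)
    (x1 : mor A B1) (y1 : mor B1 D1) (d1 : E D1 A)
    (x2 : mor A B2) (y2 : mor B2 D2) (d2 : E D2 A) :
  xi (Tri x1 y1 d1) -> xi (Tri x2 y2 d2) ->
  exists (L : Cat) (m1 : mor B1 L) (e2 : mor L D2) (m2 : mor B2 L)
         (e1 : mor L D1),
    xi (Tri m1 e2 (push x1 d2)) /\ xi (Tri m2 e1 (push x2 d1)).
Proof.
move=> xT1 xT2.
have [L [m1 [e2 [m2 [e1 [s1 s2]]]]]] := etri_pushout (xi_s xT1) (xi_s xT2).
exists L, m1, e2, m2, e1.
by split; apply: xi_ext_tri => //; apply: xi_ext_push; apply: xi_tri_ext;
  eassumption.
Qed.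

(* The base change of [d3] along a deflation [w] realizing [pull e d2] dies
   under [push f], so it is a base change of [d1]; saturation applies. *)
Lemma xi_ET4 (A B D C F : Cat) (f : mor A B) (f' : mor B D) (d1 : E D A)
    (g : mor B C) (g' : mor C F) (d2 : E F B) :
  xi (Tri f f' d1) -> xi (Tri g g' d2) ->
  exists (X : Cat) (h' : mor C X) (d : mor D X) (e : mor X F) (d3 : E X A),
    [/\ h' ∘ g = d ∘ f', e ∘ h' = g', xi (Tri (g ∘ f) h' d3)
      & xi (Tri d e (push f' d2))] /\
    (pull d d3 = d1 /\ push f d3 = pull e d2).
Proof.
move=> xT1 xT2.
have [X [h' [d [e [d3 [[e1 e2 s3 s4] [e3 e4]]]]]]] :=
  extri_ET4 extri (xi_s xT1) (xi_s xT2).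
exists X, h', d, e, d3; split=> //; split=> //; last first.
  by apply: xi_ext_tri => //; apply/xi_ext_push/xi_tri_ext/xT2.
have [W [w' [w xW]]] := xi_ext_pull e (xi_tri_ext xT2).
have [k ek] : exists k, pull w d3 = pull k d1.
  apply: (push_infl_eq0 (xi_s xT1)).
  by rewrite push_pull e4; apply: pull_defl (xi_s xW).
have [L [l [m sL]]] := real_ex s_real (pull w d3).
apply: (xi_saturated proper_xi s3 xW (l := l) (m := m)).
by apply: xi_ext_tri => //; rewrite ek; apply/xi_ext_pull/xi_tri_ext/xT1.
Qed.

(** Here [pull g d3] is the cobase change [push d d1], so saturation against the second triangle
    applies directly. *)
Lemma xi_ET4op (A B C D F : Cat) (f' : mor D A) (f : mor A B) (d1 : E B D)
    (g' : mor F B) (g : mor B C) (d2 : E C F) :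
  xi (Tri f' f d1) -> xi (Tri g' g d2) ->
  exists (X : Cat) (h' : mor X A) (d : mor D X) (e : mor X F) (d3 : E C X),
    [/\ f ∘ h' = g' ∘ e, h' ∘ d = f', xi (Tri h' (g ∘ f) d3)
      & xi (Tri d e (pull g' d1))] /\
    (push e d3 = d2 /\ push d d1 = pull g d3).
Proof.
move=> xT1 xT2.
have [X [h' [d [e [d3 [[e1 e2 s3 s4] [e3 e4]]]]]]] :=
  extri_ET4op extri (xi_s xT1) (xi_s xT2).
exists X, h', d, e, d3; split=> //; split=> //; last first.
  by apply: xi_ext_tri => //; apply/xi_ext_pull/xi_tri_ext/xT1.
have [L [l [m sL]]] := real_ex s_real (pull g d3).
apply: (xi_saturated proper_xi s3 xT2 (l := l) (m := m)).
by apply: xi_ext_tri => //; rewrite -e4; apply/xi_ext_push/xi_tri_ext/xT1.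
Qed.

(** * Relative injectives and rigid objects *)

Lemma injective_extend (I A B D : Cat) (x : mor A B) (y : mor B D) (d : E D A)
    (f : mor A I) :
  injective_obj xi I -> xi (Tri x y d) -> exists g, g ∘ x = f.
Proof. by move=> Iinj xT; have [_ _ /(_ f)] := Iinj _ xT. Qed.

Lemma injective_ext_eq0 (I D : Cat) (d : E D I) :
  injective_obj xi I -> xi_ext d -> d = 0.
Proof.
move=> Iinj [B [x [y xT]]].
have [r rx] := injective_extend (idm I) Iinj xT.
by rewrite -[d]push_id -rx push_comp (push_infl (xi_s xT)) push0.
Qed.

Lemma injective_retract (I J : Cat) (i : mor J I) (r : mor I J) :
  injective_obj xi I -> r ∘ i = idm J -> injective_obj xi J.
Proof.
move=> Iinj ri [A B D x y d] xT; have [/= minj _ _] := Iinj _ xT; split=> /=.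
- move=> u v; rewrite /precomp => uv.
  rewrite -[u]comp1m -[v]comp1m -ri -!compA; congr (_ ∘ _).
  by apply: minj; rewrite /precomp -!compA uv.
- move=> v; rewrite /precomp; split=> [|[u <-]].
    by move/(defl_factor (xi_s xT)) => [u ->]; exists u.
  by rewrite -compA (defl_infl (xi_s xT)) compm0.
move=> w; have [g gx] := injective_extend (i ∘ w) Iinj xT.
by exists (r ∘ g); rewrite /precomp -compA gx compA ri comp1m.
Qed.

Lemma injective_quasi (I : Cat) : injective_obj xi I -> quasi_injective xi I.
Proof. by move=> Iinj A B x y d; apply: Iinj. Qed.

Lemma zero_injective (Z : Cat) : is_zero Z -> injective_obj xi Z.
Proof.
move=> Z0 [A B D x y d] xT; split=> /=.
- by move=> u v _; rewrite ((Z0 _).2 u) ((Z0 _).2 v).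
- move=> v; split=> _; last exact: (Z0 _).2.
  by exists 0; rewrite ((Z0 _).2 v); apply: (Z0 _).2.
by move=> w; exists 0; rewrite ((Z0 _).2 w); apply: (Z0 _).2.
Qed.

Lemma zero_obj_is_zero : is_zero (zero_obj Cat).
Proof. by move=> B; split=> f; [apply: zero_initial|apply: zero_terminal]. Qed.

(* The vanishing of relative [Ext^1] from, and of the kernel of
   [C(Q, A) -> xixt^0(Q, A)] for, quasi-injective [Q]. *)
Definition rigid (A : Cat) : Prop :=
  forall Q, quasi_injective xi Q ->
    (forall d : E Q A, xi_ext d -> d = 0) /\
    (forall (B D : Cat) (x : mor A B) (y : mor B D) (d : E D A)
        (f : mor Q A), xi (Tri x y d) -> x ∘ f = 0 -> f = 0).

Lemma rigid_lift (A B D Q : Cat) (x : mor A B) (y : mor B D) (d : E D A)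
    (q : mor Q D) :
  rigid A -> xi (Tri x y d) -> quasi_injective xi Q -> exists u, y ∘ u = q.
Proof.
move=> rA xT Qq; apply: (defl_lift (xi_s xT)); apply: (rA Q Qq).1.
exact/xi_ext_pull/xi_tri_ext/xT.
Qed.

Lemma rigid_QI_exact (A B D : Cat) (x : mor A B) (y : mor B D) (d : E D A) :
  rigid A -> xi (Tri x y d) -> QI_exact xi (Tri x y d).
Proof.
move=> rA xT Q Qq; split=> /=.
- move=> u v; rewrite /postcomp => uv; apply/eqP; rewrite -subr_eq0; apply/eqP.
  by apply: ((rA Q Qq).2 _ _ _ _ _ _ xT); rewrite compBr uv subrr.
- move=> v; rewrite /postcomp; split=> [|[u <-]].
    by move/(infl_factor (xi_s xT)) => [u ->]; exists u.
  by rewrite compA (defl_infl (xi_s xT)) comp0m.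
by move=> w; apply: rigid_lift w rA xT Qq.
Qed.

(** By injectivity of [I], [x] extends along any xi-inflation out of [A]. Hence each extension in
    [xi] by [A] is [pull c d], which dies once [c] lifts along [y], and each such inflation is as
    monic on C(Q, -) as [x] is. *)
Lemma QI_exact_rigid (A I D : Cat) (x : mor A I) (y : mor I D) (d : E D A) :
  injective_obj xi I -> xi (Tri x y d) -> QI_exact xi (Tri x y d) -> rigid A.
Proof.
move=> Iinj xT ex Q Qq; have [/= xmono _ ylift] := ex Q Qq; split.
  move=> h [B [u [v xT']]]; have [b bu] := injective_extend x Iinj xT'.
  have [|c [cv ec]] := et3 (xi_s xT') (xi_s xT) (a := idm A) (b := b).
    by rewrite compm1.
  rewrite -[h]push_id ec; have [k <-] := ylift c.
  by rewrite /postcomp pull_comp (pull_defl (xi_s xT)) pull0.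
move=> B D' x' y' d' f xT' x'f; have [b bx'] := injective_extend x Iinj xT'.
by apply: xmono; rewrite /postcomp compm0 -bx' -compA x'f compm0.
Qed.

Lemma rigid_retract (A A' : Cat) (i : mor A A') (r : mor A' A) :
  rigid A' -> r ∘ i = idm A -> rigid A.
Proof.
move=> rA' ri Q Qq; split=> [d xd|B D x y d f xT xf].
  rewrite -[d]push_id -ri push_comp.
  by rewrite ((rA' Q Qq).1 (push i d)) ?push0 //; apply: xi_ext_push.
have [B' [x' [y' xT']]] := xi_ext_push i (xi_tri_ext xT).
have [|b [bx _]] := real_mor s_real (xi_s xT) (xi_s xT') (a := i) (c := idm D).
  by rewrite pull_id.
rewrite -[f]comp1m -ri -compA ((rA' Q Qq).2 _ _ _ _ _ (i ∘ f) xT') ?compm0 //.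
by rewrite compA -bx -compA xf compm0.
Qed.

(** ET4 yields triangles N → B → V and G → V → Q. Rigidity of [G] gives a section of V → Q and
    rigidity of [N] lifts it to [B], which splits the extension [h]. Monicity is likewise checked
    first in [G], then in [N]. *)
Lemma rigid_extension (N X G : Cat) (x : mor N X) (y : mor X G) (d : E G N) :
  xi (Tri x y d) -> rigid N -> rigid G -> rigid X.
Proof.
move=> xT rN rG Q Qq; split.
  move=> h [B [u [v xT']]].
  have [V [h' [j [e [d3 [[eh' eeh xB xV] _]]]]]] := xi_ET4 xT xT'.
  have [k ek] := rigid_lift (idm Q) rG xV Qq.
  have [l el] := rigid_lift k rN xB Qq.
  rewrite -[h]pull_id.
  have -> : idm Q = v ∘ l by rewrite -eeh -compA el ek.
  by rewrite pull_comp (pull_defl (xi_s xT')) pull0.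
move=> B D u v h f xT' uf.
have [V [h' [j [e [d3 [[eh' eeh xB xV] _]]]]]] := xi_ET4 xT xT'.
have [|g eg] := infl_factor (xi_s xT) (f := f).
  apply: ((rG Q Qq).2 _ _ _ _ _ _ xV).
  by rewrite compA -eh' -compA uf compm0.
rewrite eg; rewrite ((rN Q Qq).2 _ _ _ _ _ g xB) ?compm0 //.
by rewrite -compA -eg.
Qed.

Lemma injective_rigid (I : Cat) : injective_obj xi I -> rigid I.
Proof.
move=> Iinj Q Qq; split=> [d|B D x y d f xT xf].
  exact: injective_ext_eq0.
have [r rx] := injective_extend (idm I) Iinj xT.
by rewrite -[f]comp1m -rx -compA xf compm0.
Qed.

Lemma bip_injective (I J : Cat) :
  injective_obj xi I -> injective_obj xi J -> injective_obj xi (bip I J).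
Proof.
move=> Iinj Jinj [A B D x y d] xT.
have [/= Imono _ _] := Iinj _ xT; have [/= Jmono _ _] := Jinj _ xT.
have bipE (X : Cat) (u : mor X (bip I J)) :
    u = inl_ I J ∘ (prl_ I J ∘ u) + inr_ I J ∘ (prr_ I J ∘ u).
  by rewrite !compA -compDl bip_id comp1m.
split=> /=.
- move=> u v; rewrite /precomp => uv; rewrite (bipE _ u) (bipE _ v).
  by congr (_ + _); congr (_ ∘ _); [apply: Imono|apply: Jmono];
     rewrite /precomp -!compA uv.
- move=> v; rewrite /precomp; split=> [|[u <-]].
    by move/(defl_factor (xi_s xT)) => [u ->]; exists u.
  by rewrite -compA (defl_infl (xi_s xT)) compm0.
move=> w.
have [g gx] := injective_extend (prl_ I J ∘ w) Iinj xT.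
have [h hx] := injective_extend (prr_ I J ∘ w) Jinj xT.
exists (inl_ I J ∘ g + inr_ I J ∘ h).
by rewrite /precomp compDl -!compA gx hx -bipE.
Qed.

Lemma injective_extension (I W J : Cat) (x : mor I W) (y : mor W J)
    (d : E J I) :
  xi (Tri x y d) -> injective_obj xi I -> injective_obj xi J ->
  injective_obj xi W.
Proof.
move=> xT Iinj Jinj.
have d0 := injective_ext_eq0 Iinj (xi_tri_ext xT).
rewrite {}d0 in xT.
have [b [[b' [b'b bb']] _ _]] :=
  (real_class s_real x y (s_zero I J)).1 (xi_s xT).
exact: injective_retract (bip_injective Iinj Jinj) bb'.
Qed.

(** * Coinduction for quasi-Gorenstein injectives *)

Definition left_step (P : Cat -> Prop) (X : Cat) : Prop :=
  exists (X' Z : Cat) (x : mor X' Z) (y : mor Z X) (d : E X X'),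
    [/\ injective_obj xi Z, xi (Tri x y d) & P X'].

Definition right_step (P : Cat -> Prop) (X : Cat) : Prop :=
  exists (Z X' : Cat) (x : mor X Z) (y : mor Z X') (d : E X' X),
    [/\ injective_obj xi Z, xi (Tri x y d) & P X'].

(** Syzygies and cosyzygies chosen one after the other splice into a complex infinite in both
    directions; rigidity of its kernels makes the triangles exact for quasi-injectives. *)
Lemma QGI_coind (P : Cat -> Prop) (A : Cat) :
  (forall X, P X -> [/\ rigid X, left_step P X & right_step P X]) ->
  P A -> QGI xi A.
Proof.
move=> HP PA.
pose lstep (u v : {X | P X}) := exists (Z : Cat) (x : mor (sval v) Z)
  (y : mor Z (sval u)) (d : E _ _), injective_obj xi Z /\ xi (Tri x y d).
have [|lft lftP] := @choice _ _ lstep.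
  move=> [X PX]; have [_ [X' [Z [x [y [d [Zinj xT PX']]]]]] _] := HP X PX.
  by exists (exist _ X' PX'), Z, x, y, d.
have [|rgt rgtP] := @choice _ _ (fun u v => lstep v u).
  move=> [X PX]; have [_ _ [Z [X' [x [y [d [Zinj xT PX']]]]]]] := HP X PX.
  by exists (exist _ X' PX'), Z, x, y, d.
pose a : {X | P X} := exist _ A PA.
(* [Negz n] is -(n + 1), so it takes [n.+1] cosyzygies, while [sy 0] is [A] itself. *)
pose sy (n : int) : {X | P X} :=
  match n with Posz n => iter n lft a | Negz n => iter n.+1 rgt a end.
have step n : exists (Z : Cat) (x : mor (sval (sy (n + 1))) Z)
    (y : mor Z (sval (sy n))) (d : E _ _),
    injective_obj xi Z /\ xi (Tri x y d).
  case: n => [n|[|n]].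
  - by have -> : Posz n + 1 = Posz n.+1 by [lia]; apply: lftP.
  - by have -> : Negz 0 + 1 = Posz 0 by []; apply: rgtP.
  by have -> : Negz n.+1 + 1 = Negz n by [lia]; apply: rgtP.
(* A [complex] is data, so the witnesses are extracted by choice. *)
have {step}st n : {Z : Cat & {x : mor (sval (sy (n + 1))) Z &
    {y : mor Z (sval (sy n)) & {d : E _ _ |
      injective_obj xi Z /\ xi (Tri x y d)}}}}.
  have [Z /cid[x /cid[y /cid[d h]]]] := cid (step n).
  by exists Z, x, y, d.
pose Z n := projT1 (st n).
pose xin n : mor (sval (sy (n + 1))) (Z n) := projT1 (projT2 (st n)).
pose yout n : mor (Z n) (sval (sy n)) := projT1 (projT2 (projT2 (st n))).
pose ex n : E (sval (sy n)) (sval (sy (n + 1))) :=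
  sval (projT2 (projT2 (projT2 (st n)))).
have stP n : injective_obj xi (Z n) /\ xi (Tri (xin n) (yout n) (ex n)) :=
  svalP (projT2 (projT2 (projT2 (st n)))).
have d2 n : (xin n ∘ yout (n + 1)) ∘ (xin (n + 1) ∘ yout (n + 1 + 1)) = 0.
  rewrite compA -(compA (xin n)) (defl_infl (xi_s (stP (n + 1)).2)).
  by rewrite compm0 comp0m.
pose X := Complex d2.
pose K : xi_resolution xi X :=
  @XiResolution _ _ xi X _ xin yout ex (fun n => (stP n).2) (fun=> erefl).
exists X, K; split.
- by move=> n; apply: (stP n).1.
- move=> n; apply: rigid_QI_exact; last exact: (stP n).2.
  by have [] := HP _ (svalP (sy (n + 1))).
by exists 0.
Qed.

(** Converse to [QGI_coind]: all kernels of one complex lie in [QGI], so this class satisfies the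
    coinduction hypothesis itself. *)
Lemma QGI_steps (A : Cat) :
  QGI xi A -> [/\ rigid A, left_step (QGI xi) A & right_step (QGI xi) A].
Proof.
move=> [X [K [Xinj Kex [n <-]]]].
have QGIsyz m : QGI xi (syz K m) by exists X, K; split=> //; exists m.
split.
(* [syz K n] is the source of the triangle of index [n - 1]. *)
- rewrite -[n](subrK 1).
  exact: QI_exact_rigid (Xinj _) (syz_xi K (n - 1)) (Kex _).
- by do 5!eexists; split; [|apply: (syz_xi K n)|].
rewrite -[n](subrK 1).
by do 5!eexists; split; [|apply: (syz_xi K (n - 1))|].
Qed.

Lemma QGI_rigid (A : Cat) : QGI xi A -> rigid A.
Proof. by case/QGI_steps. Qed.

Lemma injective_QGI (I : Cat) : injective_obj xi I -> QGI xi I.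
Proof.
have inj0 := zero_injective zero_obj_is_zero.
apply: QGI_coind => X Xinj; split; first exact: injective_rigid.
  by do 5!eexists; split; [|apply: (xi_0_idm X)|].
by do 5!eexists; split; [|apply: (xi_idm_0 X)|].
Qed.

(** * Closure of [QGI] under extensions and cancellation of injectives *)

(** Pushing out a cosyzygy triangle of the summand [G] along G → L keeps the cosyzygy [G1]; the new
    middle term is an extension of [J] by [I], hence injective. *)
Lemma right_step_add_injective (J L G : Cat) (x : mor J L) (y : mor L G) :
  s (Tri x y (0 : E G J)) -> injective_obj xi J -> QGI xi G ->
  right_step (QGI xi) L.
Proof.
move=> sT Jinj /QGI_steps[_ _ [I [G1 [u [v [d [Iinj xT GG1]]]]]]].
have [x' [y' /(xi_split proper_xi) xT']] := etri_split_swap sT.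
have [W [m1 [e2 [m2 [e1 [xT1 xT2]]]]]] := xi_pushout xT' xT.
exists W, G1, m1, e2; eexists; split; [|exact: xT1|done].
exact: injective_extension xT2 Iinj Jinj.
Qed.

Lemma left_step_add_injective (J L G : Cat) (x : mor G L) (y : mor L J) :
  s (Tri x y (0 : E J G)) -> injective_obj xi J -> QGI xi G ->
  left_step (QGI xi) L.
Proof.
move=> sT Jinj /QGI_steps[_ [G1 [I [u [v [d [Iinj xT GG1]]]]]] _].
have [x' [y' /(xi_split proper_xi) xT']] := etri_split_swap sT.
have [W [m1 [e2 [m2 [e1 [xT1 xT2]]]]]] := xi_pullback xT' xT.
exists G1, W, m2, e1; eexists; split; [|exact: xT2|done].
exact: injective_extension xT1 Jinj Iinj.
Qed.

(** Coinduction on the class [P] of such extensions. The base change of X to J' splits since [N] is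
    rigid, so its middle term [L] has a syzygy [L1]; by ET4op a syzygy of [X] is then an extension
    of [G2] by [L1]. Cosyzygies are dual, the splitting coming from injectivity of [J]. *)
Lemma QGI_extension (N X G : Cat) (x : mor N X) (y : mor X G) (d : E G N) :
  xi (Tri x y d) -> QGI xi N -> QGI xi G -> QGI xi X.
Proof.
move=> xT GN GG.
pose P X := exists (N G : Cat) (x : mor N X) (y : mor X G) (d : E G N),
  [/\ xi (Tri x y d), QGI xi N & QGI xi G].
apply: (QGI_coind (P := P)); last by exists N, G, x, y, d.
move=> {}X {N G x y d xT GN GG} [N [G [x [y [d [xT GN GG]]]]]].
have [rN _ [J [N1 [u [v [h [Jinj xJ GN1]]]]]]] := QGI_steps GN.
have [rG [G2 [J' [u' [v' [h' [Jinj' xJ' GG2]]]]]] _] := QGI_steps GG.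
split; first exact: rigid_extension xT rN rG.
  have [L [m1 [e2 [m2 [e1 [xT1 xT2]]]]]] := xi_pullback xT xJ'.
  have d0 := (rN _ (injective_quasi Jinj')).1 _ (xi_tri_ext xT1).
  rewrite {}d0 in xT1.
  have [L1 [W [p [q [c [Winj xW GL1]]]]]] :=
    left_step_add_injective (xi_s xT1) Jinj' GN.
  have [U [a1 [a2 [a3 [a4 [[_ _ xU xU'] _]]]]]] := xi_ET4op xW xT2.
  exists U, W, a1; eexists; eexists; split; [done|exact: xU|].
  by exists L1, G2, a2, a3; eexists; split; first exact: xU'.
have [L [m1 [e2 [m2 [e1 [xT1 xT2]]]]]] := xi_pushout xT xJ.
have d0 := injective_ext_eq0 Jinj (xi_tri_ext xT2).
rewrite {}d0 in xT2.
have [W [L1 [p [q [c [Winj xW GL1]]]]]] :=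
  right_step_add_injective (xi_s xT2) Jinj GG.
have [U [a1 [a2 [a3 [a4 [[_ _ xU xU'] _]]]]]] := xi_ET4 xT1 xW.
exists W, U; eexists; exists a1; eexists; split; [done|exact: xU|].
by exists N1, L1, a2, a3; eexists; split; first exact: xU'.
Qed.

(** Coinduction on the complements of injectives in objects of [QGI]. A syzygy of [Y] serves for
    [X], and a cosyzygy of [X] is an extension of one of [Y] by [J]. *)
Lemma QGI_cancel_injective (X Y J : Cat) (x : mor X Y) (y : mor Y J) :
  s (Tri x y (0 : E J X)) -> injective_obj xi J -> QGI xi Y -> QGI xi X.
Proof.
move=> sT Jinj GY.
pose P X := exists (Y J : Cat) (x : mor X Y) (y : mor Y J),
  [/\ s (Tri x y (0 : E J X)), injective_obj xi J & QGI xi Y].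
have QGIP Z : QGI xi Z -> P Z.
  move=> GZ; exists Z, (zero_obj Cat), (idm Z), 0; split=> //.
    exact: etri_idm_0.
  exact: zero_injective zero_obj_is_zero.
apply: (QGI_coind (P := P)); last by exists Y, J, x, y.
move=> {}X {Y J x y sT Jinj GY} [Y [J [x [y [sT Jinj GY]]]]].
have [rY [Y1 [Z [u [v [h [Zinj xZ GY1]]]]]] [I [Y2 [p [q [c [Iinj xI GY2]]]]]]]
  := QGI_steps GY.
have xT := xi_split proper_xi sT; split.
- have [|r rx] := infl_extend sT (f := idm X); first by rewrite push0.
  exact: rigid_retract rY rx.
- have [W [a1 [a2 [a3 [a4 [[_ _ xW xW'] _]]]]]] := xi_ET4op xZ xT.
  exists Y1, W, a2, a3; eexists; split; [|exact: xW'|exact: QGIP].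
  have rY1 := QGI_rigid GY1.
  have [t ty] : exists t, y ∘ t = idm J.
    by apply: (defl_lift sT); rewrite pull0.
  (* The section [t] of [y] lifts along [v], so Z → J splits and its kernel [W] is a retract of the
     injective [Z]. *)
  have [k vk] := rigid_lift t rY1 xZ (injective_quasi Jinj).
  have a40 : a4 = 0.
    rewrite -[a4]pull_id -ty -vk compA pull_comp.
    by rewrite (pull_defl (xi_s xW)) pull0.
  have [|r ra] := infl_extend (xi_s xW) (f := idm W).
    by rewrite a40 push0.
  exact: injective_retract Zinj ra.
have [V [a1 [a2 [a3 [a4 [[_ _ xV xV'] _]]]]]] := xi_ET4 xT xI.
exists I, V; eexists; exists a1; eexists; split; [done|exact: xV|].
by apply: QGIP; apply: QGI_extension xV' (injective_QGI Jinj) GY2.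
Qed.

(** * The dimension and its behaviour along cosyzygies *)

(** Bounds by natural numbers only: zero objects are absorbed into [QGI]. *)
Fixpoint QGdim_le (n : nat) (A : Cat) : Prop :=
  if n is m.+1 then
    exists (G K : Cat) (x : mor A G) (y : mor G K) (d : E K A),
      [/\ xi (Tri x y d), QGI xi G & QGdim_le m K]
  else QGI xi A.

Lemma QGdim_leS (n : nat) (A : Cat) : QGdim_le n A -> QGdim_le n.+1 A.
Proof.
elim: n A => [|n IHn] A.
  move=> GA; exists A, (zero_obj Cat); do 3!eexists.
  split; [exact: xi_idm_0|done|].
  exact/injective_QGI/zero_injective/zero_obj_is_zero.
move=> [G [K [x [y [d [xT GG dK]]]]]]; exists G, K, x, y, d; split=> //.
exact: IHn.
Qed.

Lemma QGdim_le_trans (m n : nat) (A : Cat) :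
  (m <= n)%N -> QGdim_le m A -> QGdim_le n A.
Proof.
move=> /subnK <-; elim: (n - m)%N => //= k IHk dA.
exact/QGdim_leS/IHk.
Qed.

Lemma QGdim_extension (n : nat) (N K G : Cat) (x : mor N K) (y : mor K G)
    (d : E G N) :
  xi (Tri x y d) -> QGdim_le n N -> QGI xi G -> QGdim_le n K.
Proof.
case: n => [|n] xT; first exact: QGI_extension xT.
move=> [G1 [N1 [u [v [h [xT1 GG1 dN1]]]]]] GG.
have [W [m1 [e2 [m2 [e1 [xW xW']]]]]] := xi_pushout xT xT1.
exists W, N1, m1, e2; eexists; split; [exact: xW| |done].
exact: QGI_extension xW' GG1 GG.
Qed.

(** The first term may be taken injective: ET4 composes M → G with G → I, and the new cosyzygy is an
    extension of [G'] by [N]. *)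
Lemma QGdim_right_step (n : nat) (M : Cat) :
  QGdim_le n.+1 M -> right_step (QGdim_le n) M.
Proof.
move=> [G [N [x [y [d [xT /QGI_steps[_ _ GS] dN]]]]]].
have [I [G' [u [v [h [Iinj xT' GG']]]]]] := GS.
have [K [a1 [a2 [a3 [a4 [[_ _ xK xK'] _]]]]]] := xi_ET4 xT xT'.
exists I, K; do 3!eexists; split; [done|exact: xK|].
exact: QGdim_extension xK' dN GG'.
Qed.

Lemma QGdim_add_injective (n : nat) (I W K : Cat) (x : mor I W) (y : mor W K)
    (d : E K I) :
  xi (Tri x y d) -> injective_obj xi I -> QGdim_le n K -> QGdim_le n W.
Proof.
move=> xT Iinj dK; have d0 := injective_ext_eq0 Iinj (xi_tri_ext xT).
rewrite {}d0 in xT; have [x' [y' sT]] := etri_split_swap (xi_s xT).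
exact: QGdim_extension (xi_split proper_xi sT) dK (injective_QGI Iinj).
Qed.

Lemma QGdim_cancel_injective (n : nat) (I W K : Cat) (x : mor I W)
    (y : mor W K) (d : E K I) :
  xi (Tri x y d) -> injective_obj xi I -> QGdim_le n W -> QGdim_le n K.
Proof.
move=> xT Iinj; have d0 := injective_ext_eq0 Iinj (xi_tri_ext xT).
rewrite {}d0 in xT; have [x' [y' sT]] := etri_split_swap (xi_s xT).
case: n => [|n]; first exact: QGI_cancel_injective sT Iinj.
move=> [G [N [u [v [h [xT' GG dN]]]]]].
have [V [a1 [a2 [a3 [a4 [[_ _ xV xV'] _]]]]]] :=
  xi_ET4 (xi_split proper_xi sT) xT'.
exists G, V; do 3!eexists; split; [exact: xV|done|].
exact: QGdim_add_injective xV' Iinj dN.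
Qed.

(** Dual Schanuel argument: [W] is an extension of [K'] by [I] and of [K] by [J], so the bound
    passes from [K'] to [W] to [K]. At [n = 0] the predecessor stays 0, as objects of [QGI] have
    cosyzygies in [QGI]. *)
Lemma QGdim_cosyzygy (n : nat) (M I K : Cat) (x : mor M I) (y : mor I K)
    (d : E K M) :
  xi (Tri x y d) -> injective_obj xi I -> QGdim_le n M -> QGdim_le n.-1 K.
Proof.
move=> xT Iinj dM.
have [J [K' [x' [y' [d' [Jinj xT' dK']]]]]] : right_step (QGdim_le n.-1) M.
  by case: n dM => [/QGI_steps[]//|n]; apply: QGdim_right_step.
have [W [m1 [e2 [m2 [e1 [xW xW']]]]]] := xi_pushout xT xT'.
exact: QGdim_cancel_injective xW' Jinj (QGdim_add_injective xW Iinj dK').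
Qed.

(** * Approximations and sequences with one non-injective term *)

Fixpoint injdim_le (n : nat) (A : Cat) : Prop :=
  if n is m.+1 then right_step (injdim_le m) A else injective_obj xi A.

(** An approximation of Auslander-Buchweitz type. Induction gives K → G → N; ET4op with a syzygy of
    [G] turns it into G' → U → K with [U] of finite injective dimension, and the pullback of [I] and
    [U] over [K] is an extension of [I] by [G']. *)
Lemma QGdim_approximation (n : nat) (M : Cat) :
  QGdim_le n.+1 M ->
  exists (G U : Cat) (x : mor M G) (y : mor G U) (d : E U M),
    [/\ xi (Tri x y d), QGI xi G & injdim_le n U].
Proof.
elim: n M => [|n IHn] M /QGdim_right_step[I [K [x [y [d [Iinj xT dK]]]]]].
  have [_ [K' [J [u [v [h [Jinj xT' GK']]]]]] _] := QGI_steps dK.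
  have [L [m1 [e2 [m2 [e1 [xL xL']]]]]] := xi_pullback xT xT'.
  exists L, J, m1, e2; eexists; split; [exact: xL| |exact: Jinj].
  exact: QGI_extension xL' GK' (injective_QGI Iinj).
have [G [N [u [v [h [xT' GG dN]]]]]] := IHn K dK.
have [_ [G' [J [p [q [c [Jinj xJ GG']]]]]] _] := QGI_steps GG.
have [U [a1 [a2 [a3 [a4 [[_ _ xU xU'] _]]]]]] := xi_ET4op xJ xT'.
have [L [m1 [e2 [m2 [e1 [xL xL']]]]]] := xi_pullback xT xU'.
exists L, U, m1, e2; eexists; split; first exact: xL.
  exact: QGI_extension xL' GG' (injective_QGI Iinj).
by exists J, N; do 3!eexists; split; [|exact: xU|].
Qed.

Lemma xi_exact_sequence_cons (M G0 K : Cat) (x : mor M G0) (y : mor G0 K)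
    (d : E K M) (n : nat) (G : nat -> Cat) :
  xi (Tri x y d) -> xi_exact_sequence xi K n G ->
  xi_exact_sequence xi M n.+1 (fun j => if j is k.+1 then G k else G0).
Proof.
move=> xT [L [L0 Ln HL]]; subst K.
exists (fun j => if j is k.+1 then L k else M); split=> // -[|j] jn.
  by exists x, y, d.
exact: HL.
Qed.

Lemma injdim_le_sequence (n : nat) (U : Cat) :
  injdim_le n U -> exists G : nat -> Cat,
    xi_exact_sequence xi U n G /\
    forall j, (j <= n)%N -> injective_obj xi (G j).
Proof.
elim: n U => [|n IHn] U.
  by move=> Uinj; exists (fun=> U); split=> //; exists (fun=> U).
move=> [I [K [x [y [d [Iinj xT /IHn[G [sG injG]]]]]]]].
exists (fun j => if j is k.+1 then G k else I).
by split=> [|[|j]] //; [apply: xi_exact_sequence_cons xT sG|apply: injG].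
Qed.

(** After [i] injective cosyzygies, the approximation puts the term in [QGI] in front of an
    injective coresolution of [U]. *)
Lemma QGdim_le_sequence (i n : nat) (M : Cat) :
  QGdim_le n M -> (i <= n)%N -> exists G : nat -> Cat,
    [/\ xi_exact_sequence xi M n G, QGI xi (G i)
      & forall j, (j <= n)%N -> j <> i -> injective_obj xi (G j)].
Proof.
elim: i n M => [|i IHi] [|n] M //.
- by move=> GM _; exists (fun=> M); split=> [||[]] //; exists (fun=> M).
- move=> /QGdim_approximation[G0 [U [x [y [d [xT GG0 dU]]]]]] _.
  have [G [sG injG]] := injdim_le_sequence dU.
  exists (fun j => if j is k.+1 then G k else G0).
  split=> [||[|j]] //; first exact: xi_exact_sequence_cons xT sG.
  by move=> jn _; apply: injG.
move=> /QGdim_right_step[I [K [x [y [d [Iinj xT dK]]]]]] lein.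
have [G [sG GGi injG]] := IHi n K dK lein.
exists (fun j => if j is k.+1 then G k else I).
split=> [||[|j]] //; first exact: xi_exact_sequence_cons xT sG.
by move=> jn ij; apply: injG => // e; apply: ij; rewrite e.
Qed.

Lemma sequence_QGdim_le (n : nat) (M : Cat) (G : nat -> Cat) :
  xi_exact_sequence xi M n G -> (forall j, (j <= n)%N -> QGI xi (G j)) ->
  QGdim_le n M.
Proof.
elim: n M G => [|n IHn] M G [L [L0 Ln HL]] HG.
  by rewrite -L0 Ln; apply: HG.
have [x [y [d xT]]] := HL 0%N isT.
subst M; exists (G 0%N), (L 1%N), x, y, d; split=> //; first exact: HG.
apply: (IHn _ (fun j => G j.+1)); last by move=> j jn; apply: HG.
by exists (fun j => L j.+1); split=> // j; apply: (HL j.+1).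
Qed.

(** * Comparison with the integer-valued dimension *)

Lemma QGid_leP (n : nat) (A : Cat) : QGid_le xi n%:Z A <-> QGdim_le n A.
Proof.
split; last first.
  elim: n A => [|n IHn] A; first exact: QGid_le_QGI.
  move=> [G [K [x [y [d [xT GG /IHn dK]]]]]].
  apply: (QGid_le_step _ xT GG) => //.
  by have -> : n.+1%:Z - 1 = n%:Z by lia.
(* The induction runs over all integers [z <= n], since zero objects admit the bound -1. *)
have: n%:Z <= n%:Z :> int by [].
move: {1 3}(n%:Z) => z lezn dA; elim: dA n lezn.
- move=> {}z {}A _ A0 n _; apply: (@QGdim_le_trans 0) => //.
  exact/injective_QGI/zero_injective.
- by move=> {}z {}A _ GA n _; apply: (@QGdim_le_trans 0).
move=> {}z {}A G K x y d z0 xT GG _ IHK [|n] lezn; first by lia.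
by exists G, K, x, y, d; split=> //; apply: IHK; lia.
Qed.

Lemma QGid_le_lt0 (z : int) (A : Cat) : QGid_le xi z A -> z < 0 -> is_zero A.
Proof. by case=> // {}z {}A; lia. Qed.

Lemma QGid_le_geN1 (z : int) (A : Cat) : QGid_le xi z A -> -1 <= z.
Proof. by case=> {}z *; lia. Qed.

Lemma QGid_finite_QGdim (A : Cat) :
  QGid_finite xi A -> exists n : nat, QGdim_le n A.
Proof.
move=> [z dA]; case: (lerP 0 z) => z0.
  by exists `|z|%N; apply/QGid_leP; rewrite gez0_abs.
exists 0%N; apply/injective_QGI/zero_injective.
exact: QGid_le_lt0 dA z0.
Qed.

(** * Coresolutions and vanishing of [xixt] *)

(** With these syzygies the differentials of index [n.+1] are convertible to those of [R] of index
    [n]; dimension shifting rests on this. *)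
Definition coresolution_cons (M I K : Cat) (x : mor M I) (y : mor I K)
    (d : E K M) (xT : xi (Tri x y d)) (Iinj : injective_obj xi I)
    (R : coresolution xi K) : coresolution xi M :=
  @Coresolution _ _ xi M
    (fun n => if n is m.+1 then cor_term R m else I)
    (fun n => cosyz K (cor_syz R) n)
    (fun n => match n with 0%N => x | m.+1 => cor_in R m end)
    (fun n => match n with 0%N => y | m.+1 => cor_out R m end)
    (fun n => match n with 0%N => d | m.+1 => cor_ext R m end)
    (fun n => match n with 0%N => xT | m.+1 => cor_xi R m end)
    (fun n => match n with 0%N => Iinj | m.+1 => cor_inj R m end).

Lemma coresolution_exists (B : Cat) :
  enough_injectives xi -> inhabited (coresolution xi B).
Proof.
move=> enough.
have st A : {I : Cat & {K : Cat & {x : mor A I & {y : mor I K & {d : E K A |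
    injective_obj xi I /\ xi (Tri x y d)}}}}}.
  have [I /cid[K /cid[x /cid[y /cid[d h]]]]] := cid (enough A).
  by exists I, K, x, y, d.
pose Z A := projT1 (st A).
pose N A := projT1 (projT2 (st A)).
pose xin A : mor A (Z A) := projT1 (projT2 (projT2 (st A))).
pose yout A : mor (Z A) (N A) := projT1 (projT2 (projT2 (projT2 (st A)))).
pose ex A : E (N A) A := sval (projT2 (projT2 (projT2 (projT2 (st A))))).
have stP A : injective_obj xi (Z A) /\ xi (Tri (xin A) (yout A) (ex A)) :=
  svalP (projT2 (projT2 (projT2 (projT2 (st A))))).
pose S n := iter n N B.
constructor.
(* [cosyz] reduces only on constructors, hence the matches, whose branches agree. *)
refine (@Coresolution _ _ xi B (fun n => Z (S n)) (fun n => S n.+1)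
  (fun n => match n with 0%N => xin B | m.+1 => xin (S m.+1) end)
  (fun n => yout (S n))
  (fun n => match n with 0%N => ex B | m.+1 => ex (S m.+1) end)
  _ _) => n; last exact: (stP _).1.
by case: n => [|n]; apply: (stP _).2.
Qed.

Lemma QGdim_cosyz (n m : nat) (M : Cat) (R : coresolution xi M) :
  QGdim_le n M -> QGdim_le (n - m) (cosyz M (cor_syz R) m).
Proof.
move=> dM; elim: m => [|m IHm]; first by rewrite subn0.
by rewrite subnS; apply: QGdim_cosyzygy (cor_xi R m) (cor_inj R m) IHm.
Qed.

Lemma xixt_zero_QGdim (n i : nat) (Q M : Cat) :
  QGdim_le n M -> (1 <= i)%N -> quasi_injective xi Q ->
  xixt_zero xi (n + i) Q M.
Proof.
move=> dM; case: i => // i _ Qq R; rewrite addnS.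
have rig m : (n <= m)%N -> rigid (cosyz M (cor_syz R) m).
  move=> nm; have := QGdim_cosyz m R dM.
  by rewrite (eqP nm) => /QGI_rigid.
(* The original index is now [i.+1], so the cocycle has degree [(n + i).+1]. Rigidity two cosyzygies
   after index [n + i] pulls it back to a cosyzygy, and rigidity at [n + i] lifts it to a
   coboundary. *)
apply/cohomology_eq0P; rewrite /= /postcomp => v v0.
have ov : cor_out R (n + i).+1 ∘ v = 0.
  apply: ((rig (n + i).+2 _ Q Qq).2 _ _ _ _ _ _ (cor_xi R _)); first by lia.
  by rewrite compA.
have [w ->] := infl_factor (xi_s (cor_xi R _)) ov.
have [|u <-] := rigid_lift w (rig (n + i)%N _) (cor_xi R _) Qq; first by lia.
by exists u; rewrite /cor_diff compA.
Qed.

Lemma xixt_zero_shift (m : nat) (Q M I K : Cat) (x : mor M I) (y : mor I K)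
    (d : E K M) :
  xi (Tri x y d) -> injective_obj xi I ->
  xixt_zero xi m.+2 Q M -> xixt_zero xi m.+1 Q K.
Proof. by move=> xT Iinj H R; apply: (H (coresolution_cons xT Iinj R)). Qed.

(** Composing [q] with K → I_0 gives a 1-cocycle for [M], hence the boundary of some [u]; rigidity
    of [K] cancels the inflation. *)
Lemma xixt1_zero_lift (Q M I K : Cat) (x : mor M I) (y : mor I K)
    (d : E K M) (q : mor Q K) :
  enough_injectives xi -> xi (Tri x y d) -> injective_obj xi I -> rigid K ->
  quasi_injective xi Q -> xixt_zero xi 1 Q M -> exists u, y ∘ u = q.
Proof.
move=> enough xT Iinj rK Qq H; have [R] := coresolution_exists K enough.
have /cohomology_eq0P/(_ (cor_in R 0 ∘ q)) := H (coresolution_cons xT Iinj R).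
rewrite /= /postcomp /cor_diff /= => -[|u].
  by rewrite -!compA (compA (cor_out R 0)) (defl_infl (xi_s (cor_xi R 0)))
    comp0m compm0.
move=> e; exists u; apply/eqP; rewrite -subr_eq0; apply/eqP.
apply: ((rK Q Qq).2 _ _ _ _ _ _ (cor_xi R 0)).
by rewrite compBr compA e subrr.
Qed.

(* Schanuel: [M] and [K' -> J -> K] give [M (+) J = K' (+) I]. *)
Lemma QGI_of_xixt1_zero (M I K : Cat) (x : mor M I) (y : mor I K)
    (d : E K M) :
  enough_injectives xi -> xi (Tri x y d) -> injective_obj xi I -> QGI xi K ->
  (forall Q, quasi_injective xi Q -> xixt_zero xi 1 Q M) -> QGI xi M.
Proof.
move=> enough xT Iinj GK H.
have [rK [K' [J [u [v [h [Jinj xT' GK']]]]]] _] := QGI_steps GK.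
have [L [m1 [e2 [m2 [e1 [xL xL']]]]]] := xi_pullback xT xT'.
have Jq := injective_quasi Jinj.
have [t yt] := xixt1_zero_lift v enough xT Iinj rK Jq (H J Jq).
rewrite -yt pull_comp (pull_defl (xi_s xT)) pull0 in xL.
apply: QGI_cancel_injective (xi_s xL) Jinj _.
exact: QGI_extension xL' GK' (injective_QGI Iinj).
Qed.

Lemma QGdim_of_xixt_zero (m n : nat) (M : Cat) :
  enough_injectives xi -> QGdim_le m M ->
  (forall i Q, (1 <= i)%N -> quasi_injective xi Q ->
    xixt_zero xi (n + i) Q M) -> QGdim_le n M.
Proof.
move=> enough.
(* The case [n = 0], by induction on the known bound, which drops along cosyzygies. *)
have base k A : QGdim_le k A -> (forall i Q, (1 <= i)%N ->
    quasi_injective xi Q -> xixt_zero xi i Q A) -> QGI xi A.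
  elim: k A => // k IHk A /QGdim_right_step[I [K [x [y [d [Iinj xT dK]]]]]] H.
  apply: (QGI_of_xixt1_zero enough xT Iinj); last by move=> Q; apply: H.
  apply: (IHk _ dK) => -[|i] Q // _ Qq.
  by apply: (xixt_zero_shift xT Iinj); apply: H.
elim: n m M => [|n IHn] m M dM H; first exact: base dM H.
(* Keeping the bound [m] suffices, as only finiteness of the dimension of [K] matters. *)
have [I [K [x [y [d [Iinj xT dK]]]]]] : right_step (QGdim_le m) M.
  exact/QGdim_right_step/QGdim_leS.
exists I, K, x, y, d; split=> //; first exact: injective_QGI.
apply: (IHn _ _ dK) => -[|i] Q // _ Qq; rewrite addnS.
apply: (xixt_zero_shift xT Iinj).
by have := H i.+1 Q isT Qq; rewrite addSn addnS.
Qed.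

Lemma xixt_zero_is_zero (m : nat) (Q M : Cat) :
  is_zero M -> quasi_injective xi Q -> xixt_zero xi m Q M.
Proof.
move=> M0 Qq; have GM := injective_QGI (zero_injective M0).
case: m => [|m]; last exact: (@xixt_zero_QGdim 0 m.+1).
(* In degree 0 the only coboundary is 0; the cocycle factors through [M], so it vanishes. *)
move=> R; apply/cohomology_eq0P; rewrite /= /postcomp => v v0; exists 0.
have rK : rigid (cosyz M (cor_syz R) 1).
  exact/QGI_rigid/(@QGdim_cosyz 0 1 M R).
have ov : cor_out R 0 ∘ v = 0.
  by apply: ((rK Q Qq).2 _ _ _ _ _ _ (cor_xi R 1)); rewrite compA.
have [w ->] := infl_factor (xi_s (cor_xi R 0)) ov.
by rewrite [w](M0 Q).2 compm0.
Qed.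

End Extriangulated.

(** * The equivalences and the supremum formula *)

Theorem theorem5p5
  (Cat : additiveCat) (E : biadditiveFunctor Cat) (s : triangle E -> Prop)
  (extri : extriangulated s) (wic : WIC s)
  (xi : triangle E -> Prop) (proper_xi : proper_class s xi)
  (enough_proj : enough_projectives xi) (enough_inj : enough_injectives xi)
  (M : Cat) (M_fin : QGid_finite xi M) (n : nat) (n_gt0 : (0 < n)%N) :
  let stmt1 := QGid_le xi n%:Z M in
  let stmt2 := forall (i : nat) (Q : Cat),
    (1 <= i)%N -> quasi_injective xi Q -> xixt_zero xi (n + i) Q M in
  let stmt3 := forall i : nat, (i <= n)%N ->
    exists G : nat -> Cat,
      [/\ xi_exact_sequence xi M n G,
          QGI xi (G i)
        & forall j : nat, (j <= n)%N -> j <> i -> injective_obj xi (G j)] in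
  let nonvanishing := fun m : nat =>
    exists Q : Cat, quasi_injective xi Q /\ ~ xixt_zero xi m Q M in
  [/\ stmt1 <-> stmt2,
      stmt1 <-> stmt3,
      ~ is_zero M ->
        exists d : nat, QGid_eq xi M d%:Z /\ nat_sup nonvanishing d
    & is_zero M ->
        QGid_eq xi M (-1) /\ forall m : nat, ~ nonvanishing m].
Proof.
move=> stmt1 stmt2 stmt3 nonvanishing.
have dimP k : QGid_le xi k%:Z M <-> QGdim_le xi k M by apply: (QGid_leP extri proper_xi).
have [m dM] : exists m, QGdim_le xi m M by apply: (QGid_finite_QGdim extri proper_xi).
have extP k : QGdim_le xi k M <-> (forall (i : nat) (Q : Cat),
    (1 <= i)%N -> quasi_injective xi Q -> xixt_zero xi (k + i) Q M).
  split=> [dk i Q|H]; first exact: (xixt_zero_QGdim extri proper_xi).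
  exact: (QGdim_of_xixt_zero extri proper_xi enough_inj dM H).
split.
- by rewrite /stmt1 dimP extP.
(* For the converse, the sequence with [i = 0] already gives the bound. *)
- rewrite /stmt1 dimP; split=> [dn i|/(_ 0%N isT)[G [sG G0 injG]]].
    exact: (QGdim_le_sequence extri proper_xi).
  apply: (sequence_QGdim_le sG) => // -[|j] jn //.
  by apply: (injective_QGI extri proper_xi) => //; apply: injG.
- move=> M0.
  have exm : exists k, `[< QGdim_le xi k M >] by exists m; apply/asboolP.
  have [d /asboolP dd dmin] := ex_minnP exm.
  exists d; split; [split; first exact/dimP|split].
  (* For [d = 0] a smaller bound would be -1, forcing [M] to be zero. *)
  + case: d {dd} dmin => [|d] dmin; first by move/QGid_le_lt0 => /(_ isT).
    have -> : d.+1%:Z - 1 = d%:Z by lia.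
    by move/dimP/asboolP/dmin; rewrite ltnn.
  + move=> k [Q [Qq nz]]; rewrite leqNgt; apply/negP => dk; apply: nz.
    by rewrite -(subnKC dk) addSnnS; apply: (extP d).1.
  move=> e He; apply: dmin; apply/asboolP/extP => i Q i1 Qq.
  (* A nonzero group in degree [e + i] with [i >= 1] would exceed the upper bound [e]. *)
  by apply: contrapT => nz; have := He _ (ex_intro _ Q (conj Qq nz)); lia.
move=> M0; split; first split.
- exact: QGid_le_zero.
- by move/QGid_le_geN1.
by move=> k [Q [Qq]]; apply; apply: (xixt_zero_is_zero extri proper_xi).
Qed.
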